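(* Let $1\le n\le 6$. Under a semi-synchronous (SSYNC) scheduler, there is no deterministic algorithm that solves the perpetual marching problem with $n$ unoriented (i.e. without any geometric agreement) LCM-robots with visibility range $1$ and weak multiplicity detection on the triangular grid.
   Context: Grid. The triangular grid has point set $\mathbb{Z}^2$; for $u,v$ with $(u_x-v_x)(u_y-v_y)\ge 0$ put $\mathrm{dist}(u,v)=|u_x-v_x|+|u_y-v_y|$, otherwise $\mathrm{dist}(u,v)=\max(|u_x-v_x|,|u_y-v_y|)$. Points at distance $1$ are adjacent, so each point has six neighbours, with offsets in cyclic order $(1,0),(0,1),(-1,1),(-1,0),(0,-1),(1,-1)$. LCM-robots. There are $n$ anonymous, oblivious robots placed on grid points (several may share a point), all running the same deterministic algorithm. Each activation of a robot at $p$ consists of Look, Compute, Move: it observes, for each of the seven points $p$ and its six neighbours, whether the number of robots there (including itself at $p$) is $0$, $1$, or at least $2$ (visibility range $1$, weak multiplicity detection); the algorithm maps this view to a destination, which is $p$ (stay) or an adjacent point; the robot moves there. No geometric agreement. Each robot expresses its view and destination through a labelling of its six neighbours by $\ell_1,\dots,\ell_6$ in cyclic order, where the starting neighbour and the rotational sense are arbitrary and are chosen adversarially at each activation. Thus views are only meaningful up to rotation and reflection, and when the destination prescribed for a view is not unique up to the symmetries of that view, the adversary selects among the equivalent destinations. SSYNC scheduler. Time proceeds in rounds; in each round the scheduler picks an arbitrary nonempty set of robots, which perform Look, Compute and Move simultaneously. Every robot is activated infinitely often. Perpetual marching. A step is a single movement of one robot to an adjacent point. An algorithm solves the perpetual marching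 problem if there are an initial configuration $C_{init}$, a nonzero vector $w\in\mathbb{Z}^2$ (giving the direction and the distance $k=\mathrm{dist}(0,w)\geq 1$) and an integer $t\ge 1$ such that in every execution from $C_{init}$ allowed by the scheduler and the adversarial labellings, for every integer $m\ge1$ there is a time at which exactly $mt$ steps have been performed, and at every such time each robot is located at its position in $C_{init}$ translated by $m\,w$. *)

(* Defs.v *)
From HB Require Import structures.
From mathcomp Require Import all_boot all_order all_algebra.
From mathcomp Require Import zify.

Set Implicit Arguments.
Unset Strict Implicit.
Unset Printing Implicit Defensive.

Import Order.TTheory GRing.Theory Num.Theory.
Local Open Scope ring_scope.

Notation point := (int * int)%type.

Definition dist (u v : point) : nat :=
  let dx := u.1 - v.1 in
  let dy := u.2 - v.2 in
  if 0 <= dx * dy then (`|dx| + `|dy|)%N else maxn `|dx| `|dy|.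

Definition adjacent (u v : point) : bool := dist u v == 1%N.

Definition offset (d : 'I_6) : point :=
  nth 0 [:: (1, 0); (0, 1); (-1, 1); (-1, 0); (0, -1); (1, -1)] d.

Lemma adjacentP (u v : point) :
  reflect (exists d, v = u + offset d) (adjacent u v).
Proof.
case: u v => [x y] [x' y']; apply: (iffP eqP) => [|[d]]; last first.
  rewrite /dist; case: d => [[|[|[|[|[|[|d]]]]]] // hd] /= [-> ->];
    case: ifP; lia.
have offsetE (d : 'I_6) dx dy : offset d = (dx, dy) -> x' = x + dx ->
    y' = y + dy -> exists d : 'I_6, (x', y') = (x, y) + offset d.
  by move=> e -> ->; exists d; rewrite e.
rewrite /dist /= => h.
have : [\/ x' = x + 1 /\ y' = y + 0, x' = x + 0 /\ y' = y + 1,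
           x' = x - 1 /\ y' = y + 1 |
           [\/ x' = x - 1 /\ y' = y + 0, x' = x + 0 /\ y' = y - 1 |
               x' = x + 1 /\ y' = y - 1]].
  move: h; case: ifP => s h.
    have [e|[e|[e|e]]] : (x' = x + 1 /\ y' = y) \/ (x' = x /\ y' = y + 1) \/
      (x' = x - 1 /\ y' = y) \/ (x' = x /\ y' = y - 1) by lia.
    - by apply: Or41; lia.
    - by apply: Or42; lia.
    - by apply: Or44; apply: Or31; lia.
    - by apply: Or44; apply: Or32; lia.
  have [e|e] : (x' = x - 1 /\ y' = y + 1) \/ (x' = x + 1 /\ y' = y - 1) by nia.
  - exact: Or43.
  - by apply: Or44; apply: Or33.
case=> [[]|[]|[]|[[]|[]|[]]].
- exact: (@offsetE (inord 0) 1 0 (ltac:(by rewrite /offset inordK))).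
- exact: (@offsetE (inord 1) 0 1 (ltac:(by rewrite /offset inordK))).
- exact: (@offsetE (inord 2) (-1) 1 (ltac:(by rewrite /offset inordK))).
- exact: (@offsetE (inord 3) (-1) 0 (ltac:(by rewrite /offset inordK))).
- exact: (@offsetE (inord 4) 0 (-1) (ltac:(by rewrite /offset inordK))).
- exact: (@offsetE (inord 5) 1 (-1) (ltac:(by rewrite /offset inordK))).
Qed.

Lemma dist0_gt0 (w : point) : (0 < dist 0%R w)%N = (w != 0).
Proof.
case: w => x y; rewrite xpair_eqE /dist /=; case: ifP => s; first by lia.
by nia.
Qed.

(* Weak multiplicity detection: zero, one, or at least two robots. *)
Inductive occupancy := Empty | Single | Multiple.

Definition observe (k : nat) : occupancy :=
  match k with 0%N => Empty | 1%N => Single | _ => Multiple end.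

(* The labels l_1, ..., l_6 are the elements 0, ..., 5 of 'I_6. *)
Record view := View {
  view_here : occupancy;
  view_around : {ffun 'I_6 -> occupancy}
}.

(* The destination is the label of a neighbour, or None to stay. *)
Definition algorithm := view -> option 'I_6.

Record labelling := Labelling { lab_start : 'I_6; lab_reversed : bool }.

(* The direction (index into offset) carrying the label j; addition and
   subtraction in 'I_6 are modulo 6. *)
Definition lab_dir (l : labelling) (j : 'I_6) : 'I_6 :=
  if lab_reversed l then lab_start l - j else lab_start l + j.

Section Robots.
Variable n : nat.

Definition config := 'I_n -> point.

Definition robots_at (C : config) (p : point) : nat :=
  #|[set i : 'I_n | C i == p]|.

Definition look (C : config) (p : point) (l : labelling) : view :=
  View (observe (robots_at C p))
       [ffun j => observe (robots_at C (p + offset (lab_dir l j)))].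

Definition destination (alg : algorithm) (C : config) (i : 'I_n)
    (l : labelling) : point :=
  if alg (look C (C i) l) is Some j then C i + offset (lab_dir l j) else C i.

(* E r is the configuration after r rounds; round r activates the robots of
   A r, robot i using the labelling L r i. *)
Definition ssync_execution (alg : algorithm) (Cinit : config)
    (E : nat -> config) : Prop :=
  exists (A : nat -> {set 'I_n}) (L : nat -> 'I_n -> labelling),
    [/\ forall i, E 0%N i = Cinit i,
        forall r, A r != set0,
        forall i r, exists2 s, (r <= s)%N & i \in A s &
        forall r i, E r.+1 i =
          if i \in A r then destination alg (E r) i (L r i) else E r i].

(* Simultaneous moves of several robots in a round count separately. *)
Definition steps (E : nat -> config) (r : nat) : nat :=
  \sum_(q < r) #|[set i : 'I_n | E q.+1 i != E q i]|.

Definition solves_perpetual_marching (alg : algorithm) : Prop :=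
  exists (Cinit : config) (w : point) (t : nat),
    [/\ w != 0, (0 < t)%N &
        forall E, ssync_execution alg Cinit E ->
        forall m, (0 < m)%N ->
          (exists r, steps E r = (m * t)%N) /\
          (forall r, steps E r = (m * t)%N ->
             forall i, E r i = Cinit i + w *+ m)].

End Robots.

(* Main.v *)
(** Since the positions are prescribed whenever the number of steps is a multiple of [t], no
    configuration can be left and reached again by moving robots, some robot moves under every
    choice of labellings, and robots that started apart never meet: each of the opposite
    behaviours could be kept up by the scheduler until it contradicts a later prescription.
    In particular robots that started together can be kept together and act as one unit.

    Delaying all units but one leads to a configuration in which only that unit has to move
    (if exactly two of six robots share a starting point, they are first separated, and one of
    them attacks the point of the other). From there a finite search plays against the algorithm:
    it reveals the contents of points and the rules of the algorithm only when they are
    needed, and finds in every case a cycle, a meeting, or a configuration in which all robots can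
    stay. *)

From Stdlib Require Import ZArith FMapPositive Classical_Prop.
Require Import Defs.
From mathcomp Require Import all_boot all_order all_algebra zify ring ssrZ.
Set Implicit Arguments. Unset Strict Implicit. Unset Printing Implicit Defensive.
Import GRing.Theory Num.Theory.

(** * The search *)

(** Most facts about executions rest on one principle, [perpetual]: if a property can be preserved
    forever while robots keep moving, then some arbitrarily late prescribed configuration has it
    too. As such a configuration is a translate of the initial one by a nonzero vector, robots that
    stay together must have started together, a robot cannot wait at its start forever, and robots
    that started together cannot be kept apart forever.

    The search enumerates neither configurations nor algorithms. A world is partial knowledge: the
    contents of some cells and, for some views, what the adversary can make the robot do. A rule has
    few possible forms: either the adversary can make the robot stay, or it cannot, and then it can
    select among a whole orbit of free neighbours under the symmetries of the view; occupied
    neighbours are excluded because robots that started apart never meet. Since only abilities of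
    the adversary are recorded, each simulated play can really be carried out against the
    algorithm. *)

Definition cell := (Z * Z)%type.
(** The search is run by [vm_compute], hence binary integers, and conditionals in place of [&&]:
    under call by value both arguments of [&&] would be evaluated. *)
Definition eqc (a b : cell) : bool := if Z.eqb a.1 b.1 then Z.eqb a.2 b.2 else false.
Definition nbr (c : cell) (d : nat) : cell :=
  let: (x, y) := c in
  match d with
  | 0 => (Z.succ x, y) | 1 => (x, Z.succ y) | 2 => (Z.pred x, Z.succ y)
  | 3 => (Z.pred x, y) | 4 => (x, Z.pred y) | _ => (Z.succ x, Z.pred y)
  end.

Definition lab (l : nat * bool) (j : nat) : nat :=
  let k := if l.2 then l.1 + 6 - j else l.1 + j in if k < 6 then k else k - 6.
(** Inverse of [lab l]; a reflection is its own inverse. *)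
Definition unlab (l : nat * bool) (d : nat) : nat :=
  if l.2 then lab l d else lab (6 - l.1, false) d.
(** The twelve symmetries of the hexagon of neighbours. *)
Definition labs : seq (nat * bool) := [seq (s, b) | b <- [:: false; true], s <- iota 0 6].

Definition eqo (a b : occupancy) : bool :=
  match a, b with
  | Empty, Empty | Single, Single | Multiple, Multiple => true
  | _, _ => false
  end.
Fixpoint eqv (u v : seq occupancy) : bool :=
  match u, v with
  | [::], [::] => true
  | a :: u', b :: v' => if eqo a b then eqv u' v' else false
  | _, _ => false
  end.
Definition relabel (u : seq occupancy) (l : nat * bool) : seq occupancy :=
  [seq nth Empty u (lab l j) | j <- iota 0 6].
(** Orbit of [d] under the stabiliser of the view: the destinations that the adversary can exchange
    for [d] by its choice of labelling. *)
Definition dir_orbit (u : seq occupancy) (d : nat) : seq nat :=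
  undup [seq lab l d | l <- labs & eqv (relabel u l) u].
Definition is_empty (o : occupancy) := if o is Empty then true else false.
Definition empty_dirs u := [seq d <- iota 0 6 | is_empty (nth Empty u d)].
Fixpoint orbits_in u (ds covered : seq nat) : seq (seq nat) :=
  if ds is d :: ds' then
    if d \in covered then orbits_in u ds' covered
    else let o := dir_orbit u d in o :: orbits_in u ds' (o ++ covered)
  else [::].
Definition orbits u := orbits_in u (empty_dirs u) [::].

Inductive trie (A : Type) := TNil | TLeaf of A | TNode of trie A & trie A & trie A.
Arguments TNil {A}.
Definition child A (a b c : A) (o : occupancy) :=
  match o with Empty => a | Single => b | Multiple => c end.
Fixpoint tget A (t : trie A) (k : seq occupancy) : option A :=
  match t, k with
  | TLeaf v, [::] => Some v
  | TNode a b c, o :: k' => tget (child a b c o) k'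
  | _, _ => None
  end.
Fixpoint tset A (t : trie A) (k : seq occupancy) (v : A) : trie A :=
  if k is o :: k' then
    let: (a, b, c) := if t is TNode a b c then (a, b, c) else (TNil, TNil, TNil) in
    match o with
    | Empty => TNode (tset a k' v) b c
    | Single => TNode a (tset b k' v) c
    | Multiple => TNode a b (tset c k' v)
    end
  else TLeaf v.

(* The key of a rule is the content of the robot's own cell followed by its six neighbours; its
   value lists directions among which the adversary can select, [[::]] meaning that it can make
   the robot stay. *)
Definition rules := trie (seq nat).
(** A rule for one view is a rule for all its relabelled forms; storing all of them spares
    normalising a view at each look-up. *)
Definition learn (t : rules) c u (ds : seq nat) : rules :=
  foldl (fun t l => tset t (c :: relabel u l) (map (unlab l) ds)) t labs.

(* A unit is a set of robots, of which the search records the cell and whether it is a single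
   robot. *)
Definition units := seq (cell * occupancy).
Fixpoint occ (us : units) (x : cell) : occupancy :=
  if us is (p, c) :: us' then
    if eqc p x then (if occ us' x is Empty then c else Multiple) else occ us' x
  else Empty.
Definition pos (us : units) i := (nth ((Z0, Z0), Empty) us i).1.
Fixpoint set_pos (us : units) (i : nat) (x : cell) : units :=
  match us, i with
  | (p, c) :: us', 0 => (x, c) :: us'
  | e :: us', i'.+1 => e :: set_pos us' i' x
  | [::], _ => [::]
  end.
(** Positions suffice, because the composition of the units does not change during an
    exploration. *)
Fixpoint same_pos (us vs : units) : bool :=
  match us, vs with
  | [::], [::] => true
  | (p, _) :: us', (q, _) :: vs' => if eqc p q then same_pos us' vs' else false
  | _, _ => false
  end.
Fixpoint visited (us : units) (s : seq units) : bool :=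
  if s is vs :: s' then (if same_pos us vs then true else visited us s') else false.
Fixpoint unit_at (us : units) (x : cell) (i : nat) : option nat :=
  if us is (p, _) :: us' then (if eqc p x then Some i else unit_at us' x i.+1) else None.

Definition zkey (z : Z) : positive :=
  match z with Z0 => xH | Zpos p => xO p | Zneg p => xI p end.
Definition grid := PositiveMap.t (PositiveMap.t occupancy).
Definition grow (g : grid) (y : Z) :=
  if PositiveMap.find (zkey y) g is Some r then r else PositiveMap.empty _.
Definition gget (g : grid) (x : cell) : option occupancy :=
  PositiveMap.find (zkey x.1) (grow g x.2).
Definition gset (g : grid) (x : cell) (o : occupancy) : grid :=
  PositiveMap.add (zkey x.2) (PositiveMap.add (zkey x.1) o (grow g x.2)) g.

Record state := State { us : units; gr : grid }.
(** The two cells are the one left and the one entered, the only ones whose contents have to be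
    updated. *)
Definition move := (units * (cell * cell))%type.
Definition relocate (g : grid) (m : move) : state :=
  let: (vs, (p, x)) := m in State vs (gset (gset g p (occ vs p)) x (occ vs x)).

(* What the search has to know to continue: the content of a cell, or the rule for a view. *)
Inductive want := Content of cell | Rule of occupancy & seq occupancy.
Inductive status := Unknown of want | Go of seq cell.
(* [closed]: all robots belong to units; [full]: all robots adjacent to a unit in [root] do. In a
   [full] world a position in which all units stay is final, as the other robots stay in [root]
   and see nothing new. *)
Record world := World { root : state; alg_rules : rules; closed : bool; full : bool }.

Definition eqw (a b : want) : bool :=
  match a, b with
  | Content x, Content y => eqc x y
  | Rule c u, Rule c' u' => if eqo c c' then eqv u u' else false
  | _, _ => false
  end.
Definition add_want w (ws : seq want) := if has (eqw w) ws then ws else w :: ws.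

Section Search.
Variable paired : bool.

(* When [paired], units 0 and 1 have started at the same point and are the only ones that may
   meet. *)
Definition in_pair (i : nat) : bool := if paired then i < 2 else false.
Definition joined (us : units) : bool :=
  if paired then eqc (pos us 0) (pos us 1) else false.
Definition parted us := if paired then ~~ joined us else false.

Section World.
Variable W : world.

Definition known (g : grid) (x : cell) : option occupancy :=
  if gget g x is Some o then Some o else if closed W then Some Empty else None.
Fixpoint view_from (g : grid) (p : cell) (ds : seq nat) : cell + seq occupancy :=
  if ds is d :: ds' then
    if known g (nbr p d) is Some o then
      match view_from g p ds' with inl x => inl x | inr u => inr (o :: u) end
    else inl (nbr p d)
  else inr [::].
Definition six := [:: 0; 1; 2; 3; 4; 5].
Definition here (g : grid) (p : cell) := if gget g p is Some o then o else Empty.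
Definition status_of (g : grid) (p : cell) : status :=
  match view_from g p six with
  | inl x => Unknown (Content x)
  | inr u => if tget (alg_rules W) (here g p :: u) is Some ds then Go (map (nbr p) ds)
             else Unknown (Rule (here g p) u)
  end.
Definition statuses (st : state) : seq status := [seq status_of (gr st) e.1 | e <- us st].

(* [None] stands for a forbidden meeting, i.e. a refutation of the world. *)
Definition moves_to (st : state) (i : nat) (x : cell) : option (seq move) :=
  let p := pos (us st) i in
  let alone := (set_pos (us st) i x, (p, x)) in
  if unit_at (us st) x 0 is Some j then
    if (if in_pair i then in_pair j else false) then Some [:: alone] else None
  (* The two robots of a joined pair have the same view, so they can be moved together or only one
     of them. Moving the second one alone would be the mirror image of moving the first, so all
     alternatives are listed under unit 0. *)
  else if (if in_pair i then joined (us st) else false) then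
    if i is 0 then
      Some [:: (set_pos (set_pos (us st) 0 x) 1 x, (p, x)); alone]
    else Some [::]
  else Some [:: alone].
Fixpoint unit_moves st i (xs : seq cell) : option (seq move) :=
  if xs is x :: xs' then
    match moves_to st i x, unit_moves st i xs' with
    | Some ms, Some ms' => Some (ms ++ ms')
    | _, _ => None
    end
  else Some [::].
Fixpoint all_moves st i (ss : seq status) : option (seq move) :=
  match ss with
  | [::] => Some [::]
  | Unknown _ :: ss' => all_moves st i.+1 ss'
  | Go xs :: ss' =>
    match unit_moves st i xs, all_moves st i.+1 ss' with
    | Some ms, Some ms' => Some (ms ++ ms')
    | _, _ => None
    end
  end.
(** Detects meetings brought about by activating two units in the same round; [moves_to] only
    detects moves onto a standing unit. *)
Fixpoint clash i (xs : seq cell) j (ss : seq status) : bool :=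
  if ss is s :: ss' then
    if (if s is Go ys then
          if (if in_pair i then in_pair j else false) then false
          else has (fun x => has (eqc x) ys) xs
        else false) then true
    else clash i xs j.+1 ss'
  else false.
Fixpoint clashes i (ss : seq status) : bool :=
  if ss is s :: ss' then
    if (if s is Go (x :: xs) then clash i (x :: xs) i.+1 ss' else false) then true
    else clashes i.+1 ss'
  else false.
Definition all_stay (ss : seq status) := all (fun s => if s is Go [::] then true else false) ss.
(** While the pair is apart, one of its robots may legitimately move onto the other. Its rule could
    then point to an occupied cell and would not be covered by the alternatives that [refute] tries,
    so it is not asked for. *)
Fixpoint wants (first : bool) (vs : units) i (ss : seq status) (ws : seq want) : seq want :=
  if ss is s :: ss' then
    wants first vs i.+1 ss'
      (if s is Unknown w then
         if parted vs then
           if first then (if (if w is Rule _ _ then in_pair i else false) then ws else add_want w ws)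
           else ws
         else add_want w ws
       else ws)
  else ws.

Inductive result := Refuted | Open of seq want & seq units.
(** Depth-first walk through the plays of the adversary. A position on the current [path] closes a
    cycle and refutes the world; one that was only [seen] on another branch is merely skipped. *)
Fixpoint explore (depth : nat) (first : bool) (path : seq units) (st : state)
    (ws : seq want) (seen : seq units) : result :=
  if depth is depth'.+1 then
    let ss := statuses st in
    if (if full W then all_stay ss else false) then Refuted else
    if clashes 0 ss then Refuted else
    if all_moves st 0 ss is Some ms then
      let path' := us st :: path in
      foldl (fun r m => if r is Open ws seen then
                          if visited m.1 path' then Refuted else
                          if visited m.1 seen then r else
                          explore depth' false path' (relocate (gr st) m) ws seen else Refuted)
            (Open (wants first (us st) 0 ss ws) (us st :: seen)) ms
    else Refuted
  else Open ws seen.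
End World.

Variables (tab : trie (seq (seq nat))) (max_units : nat) (stacks : bool).

(** A lower bound for the number of robots, as [Multiple] stands for two or more. *)
Definition weight (us : units) :=
  foldr (fun e k => (if e.2 is Multiple then 2 else 1) + k) 0 us.
Definition can_single us := if size us < max_units then weight us < 6 else false.
Definition can_multiple us :=
  if stacks then (if size us < max_units then weight us < 5 else false) else false.

(* In the root configuration all units but the first one can be made to stay. *)
Fixpoint settle (W : world) (us : units) : option world :=
  if us is (p, _) :: us' then
    let g := gr (root W) in
    if view_from W g p six is inr u then
      match tget (alg_rules W) (here g p :: u) with
      | Some [::] => settle W us'
      (* The rule forbids staying, so the assumed world is impossible. *)
      | Some _ => None
      | None => settle (World (root W) (learn (alg_rules W) (here g p) u [::])
                              (closed W) (full W)) us'
      end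
    else settle W us'
  else Some W.
(** When not even a single robot fits into the budget of units and robots any more, the units
    contain all robots and every unrecorded cell is empty. *)
Definition make_world (R : state) (t : rules) : option world :=
  let cl := ~~ can_single (us R) in
  let fl := if cl then true
            else all (fun e => all (fun d => isSome (gget (gr R) (nbr e.1 d))) six) (us R) in
  settle (World R t cl fl) (behead (us R)).
Definition reveal (R : state) (x : cell) (o : occupancy) : state :=
  State (if o is Empty then us R else rcons (us R) (x, o)) (gset (gr R) x o).

Definition options u := odflt [::] (tget tab u).
Definition branching (us : units) (w : want) : nat :=
  if w is Rule _ u then (size (options u)).+1
  else 1 + can_single us + can_multiple us.
(** A question with the fewest possible answers is branched on. *)
Fixpoint best (us : units) (ws : seq want) (b : option (nat * want)) : option want :=
  if ws is w :: ws' then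
    let k := branching us w in
    best us ws' (if b is Some (m, _) then (if m < k then b else Some (k, w)) else Some (k, w))
  else omap snd b.

Fixpoint refute (fuel : nat) (W : world) : bool :=
  if fuel is fuel'.+1 then
    (* Plays of length 10 are enough for all the refutations below; soundness is proved for every
       depth. *)
    if explore W 10 true [::] (root W) [::] [::] is Open ws _ then
      let sub R t := if make_world R t is Some W' then refute fuel' W' else true in
      match best (us (root W)) ws None with
      | None => false
      | Some (Content x) =>
        (* This guard gives [reveal_ok] its hypothesis that the cell is new. *)
        if isSome (gget (gr (root W)) x) then false else
        if sub (reveal (root W) x Empty) (alg_rules W) then
          if (if can_single (us (root W))
              then sub (reveal (root W) x Single) (alg_rules W) else true) then
            if can_multiple (us (root W))
            then sub (reveal (root W) x Multiple) (alg_rules W) else true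
          else false
        else false
      | Some (Rule c u) =>
        if sub (root W) (learn (alg_rules W) c u [::]) then
          all (fun o => sub (root W) (learn (alg_rules W) c u o)) (options u)
        else false
      end
    else true
  else false.
Definition reveal_ring (R : state) (u : seq occupancy) (ds : seq nat) : state :=
  foldl (fun R d => let x := nbr (Z0, Z0) d in
           (* In a couple the cell of the partner is already recorded. *)
           if isSome (gget (gr R) x) then R else reveal R x (nth Empty u d)) R ds.
(** [None] means that the root cannot occur: the view exceeds the budget, or its rule contradicts
    that the other units can stay. *)
Definition start (R : state) (c : occupancy) u ds : option world :=
  let R' := reveal_ring R u six in
  if (if size (us R') <= max_units then weight (us R') <= 6 else false)
  then make_world R' (learn TNil c u ds) else None.
End Search.

Fixpoint views (os : seq occupancy) (k : nat) : seq (seq occupancy) :=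
  if k is k'.+1 then [seq o :: u | o <- os, u <- views os k'] else [:: [::]].
Fixpoint lexle (u v : seq occupancy) : bool :=
  match u, v with
  | a :: u', b :: v' =>
    match a, b with
    | Empty, Empty | Single, Single | Multiple, Multiple => lexle u' v'
    | Empty, _ | Single, Multiple => true
    | _, _ => false
    end
  | _, _ => true
  end.
(** Selects one view per class under relabelling; [good_labelling] turns the chart so that the view
    at the root is of this form. *)
Definition canonical u := all (fun l => lexle u (relabel u l)) labs.
Definition roots os := [seq u <- views os 6 | canonical u].
Definition table := foldl (fun t u => tset t u (orbits u)) TNil (views [:: Empty; Single; Multiple] 6).
Definition lone c : state := State [:: ((Z0, Z0), c)] (gset (PositiveMap.empty _) (Z0, Z0) c).
Definition couple d : state := reveal (lone Single) (nbr (Z0, Z0) d) Single.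
Definition single_dirs u := [seq d <- iota 0 6 | if nth Empty u d is Single then true else false].

(** * Executions chosen by the adversary *)

Section Dynamics.
Variables (n : nat) (alg : algorithm) (C0 : config n) (w : point) (t : nat).
Hypotheses (n_gt0 : 0 < n) (w_neq0 : w != 0%R) (t_gt0 : 0 < t).
Hypothesis march : forall E, ssync_execution alg C0 E -> forall m, 0 < m ->
  (exists r, steps E r = m * t) /\
  (forall r, steps E r = m * t -> forall i, E r i = (C0 i + w *+ m)%R).

Notation cfg := {ffun 'I_n -> point}.
Notation round := ({set 'I_n} * ('I_n -> labelling))%type.

(** Finite functions have a decidable and extensional equality, which comparing configurations
    requires. *)
Definition conf (X : cfg) : config n := fun i => X i.
Definition step (X : cfg) (r : round) : cfg :=
  [ffun i => if i \in r.1 then destination alg (conf X) i (r.2 i) else X i].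
Definition moved (X Y : cfg) : nat := #|[set i | Y i != X i]|.
Fixpoint run (X : cfg) (s : seq round) : cfg := if s is r :: s' then run (step X r) s' else X.
Fixpoint cost (X : cfg) (s : seq round) : nat :=
  if s is r :: s' then moved X (step X r) + cost (step X r) s' else 0.
Definition valid (s : seq round) := all (fun r : round => r.1 != set0) s.
Definition init : cfg := [ffun i => C0 i].

Lemma run_cat X s1 s2 : run X (s1 ++ s2) = run (run X s1) s2.
Proof. by elim: s1 X => //= r s1 IH X; rewrite IH. Qed.

Lemma cost_cat X s1 s2 : cost X (s1 ++ s2) = cost X s1 + cost (run X s1) s2.
Proof. by elim: s1 X => //= r s1 IH X; rewrite IH addnA. Qed.

Lemma moved0 X Y : moved X Y = 0 -> Y = X.
Proof.
move/cards0_eq => h; apply/ffunP => i.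
by have := in_set0 i; rewrite -h inE => /negbT; rewrite negbK => /eqP.
Qed.

Lemma cost0_run X s : cost X s = 0 -> run X s = X.
Proof.
elim: s X => //= r s IH X /eqP; rewrite addn_eq0 => /andP[/eqP h1 /eqP h2].
by rewrite IH // (moved0 h1).
Qed.

Definition layer (m : nat) (X : cfg) := forall i, X i = (C0 i + w *+ m)%R.

Section Execution.
Variables (s : seq round) (lam : cfg -> 'I_n -> labelling).
Hypothesis vs : valid s.

(** Once the script [s] is used up, every round activates all robots, which makes the execution
    fair. *)
Definition next (r : nat) (X : cfg) : round := nth (setT, lam X) s r.
Fixpoint exec (r : nat) : cfg :=
  if r is r'.+1 then step (exec r') (next r' (exec r')) else init.

Lemma exec_ssync : ssync_execution alg C0 (fun r => conf (exec r)).
Proof.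
exists (fun r => (next r (exec r)).1), (fun r => (next r (exec r)).2); split.
- by move=> i; rewrite /conf ffunE.
- move=> r; rewrite /next; case: (ltnP r (size s)) => h.
    by move/all_nthP: vs; apply.
  rewrite nth_default //=; apply/set0Pn; exists (Ordinal n_gt0); exact: in_setT.
- move=> i r; exists (r + size s); first exact: leq_addr.
  by rewrite /next nth_default ?in_setT ?leq_addl.
- by move=> r i; rewrite /conf /= ffunE.
Qed.

Lemma steps_exec r :
  steps (fun r => conf (exec r)) r = \sum_(q < r) moved (exec q) (exec q.+1).
Proof. by []. Qed.

Lemma exec_take r : r <= size s ->
  exec r = run init (take r s) /\
  steps (fun r => conf (exec r)) r = cost init (take r s).
Proof.
elim: r => [|r IH] hr; first by rewrite take0 steps_exec big_ord0.
have [e1 e2] := IH (ltnW hr).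
rewrite (take_nth (setT, lam (exec r)) hr) -cats1 run_cat cost_cat steps_exec.
by rewrite big_ord_recr /= -steps_exec e2 -e1 addn0.
Qed.

Lemma exec_hit m : 0 < m ->
  exists r, steps (fun r => conf (exec r)) r = m * t /\ layer m (exec r).
Proof.
move=> m0; have [[r hr] h] := march exec_ssync m0.
by exists r; split=> // i; apply: h.
Qed.

Lemma steps_mono r1 r2 : r1 <= r2 ->
  steps (fun r => conf (exec r)) r1 <= steps (fun r => conf (exec r)) r2.
Proof.
move=> h; rewrite !steps_exec -(subnKC h) big_split_ord /=.
exact: leq_addr.
Qed.
End Execution.

Definition lab0 : labelling := Labelling ord0 false.

(** The prescription concerns infinite executions. The script is extended to a fair one; should the
    prescribed time lie beyond its end, then no step is made in between, and the end of the script
    is already the prescribed configuration. *)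
Lemma layer_hit s m : valid s -> 0 < m -> m * t <= cost init s ->
  exists2 r, r <= size s & cost init (take r s) = m * t /\ layer m (run init (take r s)).
Proof.
move=> vs m0 hm.
have [r [hr hl]] := exec_hit (fun _ _ => lab0) vs m0.
case: (leqP r (size s)) => h.
  have [e1 e2] := exec_take (fun _ _ => lab0) h.
  by exists r => //; rewrite -e1 -e2.
have [e1 e2] := exec_take (fun _ _ => lab0) (leqnn (size s)).
have := steps_mono s (fun _ _ => lab0) (ltnW h); rewrite e2 hr take_size => hle.
have ec : cost init s = m * t by apply/eqP; rewrite eqn_leq hm hle.
exists (size s) => //; rewrite take_size; split=> //.
have [r0 hr0] : exists d, r = size s + d by exists (r - size s); rewrite subnKC // ltnW.
have same d : steps (fun r => conf (exec s (fun _ _ => lab0) r)) (size s + d) = m * t ->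
    exec s (fun _ _ => lab0) (size s + d) = run init s.
  elim: d => [|d IH]; first by rewrite addn0 e1 take_size.
  rewrite addnS => hs.
  have h1 := steps_mono s (fun _ _ => lab0) (leq_addr d (size s)).
  have h2 := steps_mono s (fun _ _ => lab0) (leqnSn (size s + d)).
  rewrite e2 take_size ec in h1; rewrite hs in h2.
  have h3 : steps (fun r => conf (exec s (fun _ _ => lab0) r)) (size s + d) = m * t.
    by apply/eqP; rewrite eqn_leq h1 h2.
  rewrite -(IH h3); apply: moved0.
  by move: hs; rewrite steps_exec big_ord_recr /= -steps_exec h3; lia.
by rewrite -(same r0) -hr0.
Qed.

Definition reachable X := exists2 s, valid s & run init s = X.
(** The positive cost makes [leads X X] a genuine cycle. *)
Definition leads X Y := exists2 s, valid s & run X s = Y /\ 0 < cost X s.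

Lemma reachable_step X r : reachable X -> r.1 != set0 -> reachable (step X r).
Proof.
by case=> s vs <- hr; exists (rcons s r); rewrite ?/valid ?all_rcons ?hr // -cats1 run_cat.
Qed.

Lemma leads_step X r : r.1 != set0 -> step X r != X -> leads X (step X r).
Proof.
move=> hr hX; exists [:: r]; rewrite /valid /= ?hr // addn0; split=> //.
by rewrite lt0n; apply: contra hX => /eqP/moved0->.
Qed.

Lemma leads_trans X Y Z : leads X Y -> leads Y Z -> leads X Z.
Proof.
case=> s vs [<- c] [s' vs' [<- c']]; exists (s ++ s').
  by rewrite /valid all_cat; apply/andP.
by rewrite run_cat cost_cat addn_gt0 c.
Qed.

(** If all robots stayed under [l], repeating these labellings would freeze the number of steps at
    the cost of the script, and the count [m * t] with [m] one more than this cost would never be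
    reached. *)
Lemma not_stuck X (l : 'I_n -> labelling) : reachable X ->
  exists i, destination alg (conf X) i (l i) != X i.
Proof.
case=> s vs eX.
case: (pickP (fun i => destination alg (conf X) i (l i) != X i)) => [i hi|h]; first by exists i.
exfalso.
have m0 : 0 < (cost init s).+1 by [].
have [r [hr _]] := exec_hit (fun _ => l) vs m0.
have [e1 e2] := exec_take (fun _ => l) (leqnn (size s)).
have fixX d : exec s (fun _ => l) (size s + d) = X.
  elim: d => [|d IH]; first by rewrite addn0 e1 take_size.
  rewrite addnS /= IH /next nth_default ?leq_addr //; apply/ffunP => i.
  by rewrite ffunE in_setT /=; have /negbFE/eqP := h i.
have c d : steps (fun r => conf (exec s (fun _ => l) r)) (size s + d) = cost init s.
  elim: d => [|d IH]; first by rewrite addn0 e2 take_size.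
  rewrite addnS steps_exec big_ord_recr /= -steps_exec IH.
  have -> : step (exec s (fun _ => l) (size s + d)) (next s (fun _ => l) (size s + d)
              (exec s (fun _ => l) (size s + d))) = X by rewrite -(fixX d.+1) addnS.
  rewrite fixX /moved; set A := [set _ | _]; have -> : A = set0.
    by apply/setP => i; rewrite !inE eqxx.
  by rewrite cards0 addn0.
have : steps (fun r => conf (exec s (fun _ => l) r)) r <= cost init s.
  by rewrite -(c r); apply: steps_mono; rewrite leq_addl.
by rewrite hr; nia.
Qed.

(** Rounds that keep [Q] are appended until [m * t] steps have been made. Since [m] exceeds the cost
    of [s0], the prescribed time is not inside [s0], and [Q] holds after every round that
    follows. *)
Lemma perpetual (Q : cfg -> Prop) s0 X :
  (forall Y, reachable Y -> Q Y ->
     exists r : round, [/\ r.1 != set0, Q (step Y r) & step Y r != Y]) ->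
  valid s0 -> run init s0 = X -> Q X -> forall m, cost init s0 < m ->
  exists s, [/\ valid s, Q (run X s), cost init (s0 ++ s) = m * t & layer m (run X s)].
Proof.
move=> prog vs0 eX QX m hm.
have long N : exists s, [/\ valid s, N <= cost X s &
    forall r, Q (run X (take r s))].
  elim: N => [|N [s [vs cs qs]]]; first by exists [::].
  have rY : reachable (run X s).
    by exists (s0 ++ s); rewrite ?run_cat ?eX // /valid all_cat; apply/andP.
  have qY : Q (run X s) by have := qs (size s); rewrite take_size.
  have [r [r0 qr nr]] := prog _ rY qY.
  exists (s ++ [:: r]); split.
  - by rewrite /valid all_cat /= r0 !andbT.
  - rewrite cost_cat /= addn0 -addn1; apply: leq_add => //.
    by rewrite lt0n; apply: contra nr => /eqP/moved0->.
  - move=> k; rewrite take_cat; case: ifP => // /negbT; rewrite -leqNgt => hk.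
    case: (k - size s) => [|j]; first by rewrite take0 cats0; have := qs (size s); rewrite take_size.
    by rewrite /= run_cat.
have [s [vs cs qs]] := long (m * t).
have vss : valid (s0 ++ s) by rewrite /valid all_cat; apply/andP.
have hc : m * t <= cost init (s0 ++ s) by rewrite cost_cat eX; lia.
have m0 : 0 < m by lia.
have [r hr [cr lr]] := layer_hit vss m0 hc.
have hr2 : size s0 <= r.
  rewrite leqNgt; apply/negP => h.
  have e : take r (s0 ++ s) = take r s0 by rewrite take_cat h.
  have : cost init (take r s0) <= cost init s0.
    by rewrite -{2}(cat_take_drop r s0) cost_cat leq_addr.
  by rewrite -e cr; nia.
move: lr cr; rewrite take_cat ltnNge hr2 /= run_cat eX => lr cr.
exists (take (r - size s0) s); split=> //.
by move: vs; rewrite -{1}(cat_take_drop (r - size s0) s) /valid all_cat => /andP[].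
Qed.

Lemma mulrn_pair (x y : int) m : ((x, y) *+ m = (x *+ m, y *+ m))%R.
Proof. by elim: m => [|m IH]; rewrite ?mulr0n // !mulrS IH. Qed.

Lemma mulrn_w m : 0 < m -> (w *+ m)%R != 0%R.
Proof.
case: w w_neq0 => x y h m0; rewrite mulrn_pair; apply: contra h.
by rewrite !xpair_eqE !mulrn_eq0 (gtn_eqF m0).
Qed.

Lemma layer_inj m1 m2 X i : layer m1 X -> layer m2 X -> i < n -> m1 = m2.
Proof.
move=> h1 h2 hi; have := h1 (Ordinal hi); rewrite (h2 (Ordinal hi)) => /addrI e.
wlog lt : m1 m2 h1 h2 e / m1 < m2.
  by case: (ltngtP m1 m2) => // lt h; [apply: h | apply/esym/h].
have := @mulrn_w (m2 - m1); rewrite subn_gt0 => /(_ lt).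
by rewrite mulrnBr ?(ltnW lt) // e subrr eqxx.
Qed.

(* Closing the loop [t] times before going on to a layer postpones that layer
   by [cost X l] layers. *)
Lemma no_cycle X : reachable X -> ~ leads X X.
Proof.
case=> s0 v0 eX [l vl [el cl]].
have prog Y : reachable Y -> True -> exists r : round, [/\ r.1 != set0, True & step Y r != Y].
  move=> rY _; have [i hi] := @not_stuck Y (fun _ => lab0) rY.
  exists ([set i], fun=> lab0); split=> //=; first by apply/set0Pn; exists i; rewrite inE.
  by apply: contra hi => /eqP/ffunP/(_ i); rewrite ffunE inE eqxx => ->.
have [s [vs _ cs ls]] := perpetual prog v0 eX I (ltnSn _).
have loop j : [/\ run X (flatten (nseq j l)) = X, cost X (flatten (nseq j l)) = j * cost X l &
    valid (flatten (nseq j l))].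
  elim: j => [|j [h1 h2 h3]] //=; rewrite run_cat cost_cat el h1 h2 mulSn.
  by split=> //; rewrite /valid all_cat; apply/andP.
have [lt ct vt] := loop t.
set m := (cost init s0).+1 in cs ls.
pose s2 := s0 ++ flatten (nseq t l) ++ s.
have c2 : cost init s2 = (m + cost X l) * t.
  move: cs; rewrite /s2 !cost_cat eX lt ct mulnDl (mulnC t) => <-.
  by lia.
have v2 : valid s2 by rewrite /valid !all_cat; apply/and3P.
have [|r hr [cr lr]] := layer_hit v2 _ (eq_leq (esym c2)); first by rewrite addn_gt0.
have e2 : run init s2 = run X s by rewrite !run_cat eX lt.
(* The rest of the script costs nothing and therefore moves nobody. *)
have er : run init (take r s2) = run init s2.
  rewrite -{2}(cat_take_drop r s2) run_cat (@cost0_run (run init (take r s2))) //.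
  by move: c2; rewrite -{1}(cat_take_drop r s2) cost_cat cr; lia.
rewrite er e2 in lr.
by have := layer_inj ls lr n_gt0; lia.
Qed.

(* Robots that have met can be kept together by giving them the same labelling. *)
Lemma meet_start X i j : reachable X -> X i = X j -> C0 i = C0 j.
Proof.
case=> s0 v0 eX e.
have prog Y : reachable Y -> Y i = Y j ->
    exists r : round, [/\ r.1 != set0, step Y r i = step Y r j & step Y r != Y].
  move=> rY eY; exists (setT, fun=> lab0); split=> /=.
  - by apply/set0Pn; exists i; rewrite inE.
  - by rewrite !ffunE !in_setT /= /destination /conf eY.
  - have [k hk] := @not_stuck Y (fun _ => lab0) rY.
    by apply: contra hk => /eqP/ffunP/(_ k); rewrite ffunE in_setT /= => ->.
have [s [vs q _ ls]] := perpetual prog v0 eX e (ltnSn _).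
by move: q; rewrite !ls => /addIr.
Qed.
End Dynamics.

(** * Views, relabellings and charts *)

Lemma eqoP a b : reflect (a = b) (eqo a b).
Proof. by case: a b => [] []; constructor. Qed.

Lemma eqvP u v : reflect (u = v) (eqv u v).
Proof.
apply: (iffP idP) => [|<-]; last by elim: u => //= a u ->; case: eqoP.
by elim: u v => [|a u IH] [|b v] //=; case: eqoP => // -> /IH ->.
Qed.

Lemma eqcP a b : reflect (a = b) (eqc a b).
Proof.
case: a b => [x y] [x' y']; rewrite /eqc /=.
case: (Z.eqb_spec x x') => [->|ne]; last by constructor=> -[].
by case: (Z.eqb_spec y y') => [->|ne]; constructor=> // -[].
Qed.

Lemma tget_TNil A k : tget (@TNil A) k = None. Proof. by case: k. Qed.

Lemma tget_tset A (t : trie A) k v k' v' :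
  tget (tset t k v) k' = Some v' -> (k' = k /\ v' = v) \/ tget t k' = Some v'.
Proof.
elim: k t k' => [|o k IH] t [|o' k'] //=; first by case=> <-; left.
  by case: t => [|a|a b c]; case: o.
have hit t' : tget (tset t' k v) k' = Some v' -> k' = k /\ v' = v \/ tget t' k' = Some v' := IH t' k'.
case: t => [|a|a b c]; case: o; case: o' => //= h;
  first [by right | by move: h; rewrite tget_TNil | case: (hit _ h) => [[-> ->]|]];
  by [left | rewrite tget_TNil | right].
Qed.

Lemma labs_lt l : l \in labs -> l.1 < 6.
Proof. by have /allP h : all (fun l => l.1 < 6) labs by []; exact: h. Qed.

Definition lab_of (l : nat * bool) : labelling := Labelling (inord l.1) l.2.
Definition lab_comp (g l : labelling) : labelling :=
  Labelling (lab_dir g (lab_start l)) (lab_reversed g (+) lab_reversed l).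
Definition lab_inv (l : labelling) : labelling :=
  if lab_reversed l then l else Labelling (- lab_start l)%R false.

Lemma lab_dir_comp g l j : lab_dir (lab_comp g l) j = lab_dir g (lab_dir l j).
Proof.
case: g => s b; case: l => s' b'; rewrite /lab_dir /=.
by case: b; case: b'; rewrite /= ?opprD ?opprK ?addrA.
Qed.

Lemma lab_invKV l j : lab_dir l (lab_dir (lab_inv l) j) = j.
Proof.
case: l => s [] /=; rewrite /lab_dir /lab_inv /=; last by rewrite addNKr.
by rewrite opprB addrC subrK.
Qed.

Lemma lab_ofE l (j : 'I_6) : l \in labs -> lab_dir (lab_of l) j = lab l j :> nat.
Proof.
move/labs_lt; case: l => s b /= hs; have hj := ltn_ord j.
by case: b; rewrite /lab_dir /lab /= inordK //; case: ifP; lia.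
Qed.

Lemma unlab_ofE l (j : 'I_6) : l \in labs -> lab_dir (lab_inv (lab_of l)) j = unlab l j :> nat.
Proof.
move=> hl; move: (labs_lt hl); case: l hl => s [] hl hs; first exact: (lab_ofE j hl).
rewrite /= in hs *; have hj := ltn_ord j.
by rewrite /lab_dir /unlab /lab /= inordK //; case: ifP; lia.
Qed.

Section Rules.
Variable alg : algorithm.

Definition view_of c (u : seq occupancy) (l : labelling) : view :=
  View c [ffun j => nth Empty u (lab_dir l j)].
Definition stayable c u := exists l, alg (view_of c u l) = None.
Definition possible c u (d : nat) :=
  exists l j, alg (view_of c u l) = Some j /\ lab_dir l j = d :> nat.
(** The meaning of a stored rule. A nonempty list also asserts that staying is impossible, which
    separates the branches of the search. *)
Definition rule_ok c u (ds : seq nat) :=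
  if ds is [::] then stayable c u
  else ~ stayable c u /\ forall d, d \in ds -> possible c u d.
Definition rules_ok (t : rules) :=
  forall c u ds, size u = 6 -> tget t (c :: u) = Some ds -> rule_ok c u ds.

Lemma nth_relabel u l j : j < 6 -> nth Empty (relabel u l) j = nth Empty u (lab l j).
Proof. by move=> hj; rewrite (nth_map 0) ?size_iota // nth_iota. Qed.

Lemma view_relabel c u l l' : l \in labs ->
  view_of c (relabel u l) l' = view_of c u (lab_comp (lab_of l) l').
Proof.
move=> hl; congr View; apply/ffunP => j; rewrite !ffunE nth_relabel ?ltn_ord //.
by rewrite lab_dir_comp lab_ofE.
Qed.

Lemma view_unrelabel c u l l' : l \in labs ->
  view_of c (relabel u l) (lab_comp (lab_inv (lab_of l)) l') = view_of c u l'.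
Proof.
move=> hl; rewrite view_relabel //; congr View; apply/ffunP => j.
by rewrite !ffunE !lab_dir_comp lab_invKV.
Qed.

Lemma stayable_relabel c u l : l \in labs -> stayable c (relabel u l) <-> stayable c u.
Proof.
move=> hl; split=> -[l' h]; last first.
  by exists (lab_comp (lab_inv (lab_of l)) l'); rewrite view_unrelabel.
by exists (lab_comp (lab_of l) l'); rewrite -view_relabel.
Qed.

Lemma possible_relabel c u l d : l \in labs ->
  possible c u d -> possible c (relabel u l) (unlab l d).
Proof.
move=> hl [l' [j [h hd]]]; exists (lab_comp (lab_inv (lab_of l)) l'), j.
by rewrite view_unrelabel // h lab_dir_comp unlab_ofE // hd.
Qed.

(** A symmetry of the view, composed with the labelling that leads to [d], leaves what the robot
    sees unchanged but turns its destination. *)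
Lemma possible_orbit c u d d' : d' \in dir_orbit u d -> possible c u d -> possible c u d'.
Proof.
rewrite mem_undup => /mapP[l]; rewrite mem_filter => /andP[/eqvP e hl] -> [l' [j [h hd]]].
exists (lab_comp (lab_of l) l'), j; split; first by rewrite -view_relabel // e.
by rewrite lab_dir_comp lab_ofE // hd.
Qed.

Lemma possible_lt c u d : possible c u d -> d < 6.
Proof. by case=> l [j [_ <-]]; apply: ltn_ord. Qed.

Lemma possible_ex c u : ~ stayable c u -> exists d, possible c u d.
Proof.
move=> h; case e: (alg (view_of c u (Labelling ord0 false))) => [j|]; last first.
  by case: h; exists (Labelling ord0 false).
by eexists; exists (Labelling ord0 false), j; split; first exact: e.
Qed.

Lemma rules_TNil : rules_ok TNil.
Proof. move=> c u ds su; rewrite tget_TNil; discriminate. Qed.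

Lemma size_relabel u l : size (relabel u l) = 6.
Proof. by rewrite size_map size_iota. Qed.

Lemma rule_relabel c u l ds : l \in labs -> rule_ok c u ds ->
  rule_ok c (relabel u l) (map (unlab l) ds).
Proof.
case: ds => [|d ds] hl; first by move/(stayable_relabel c u hl).
case=> h1 h2; split; first by move/(stayable_relabel c u hl).
by move=> d' /mapP[e /h2 he ->]; apply: possible_relabel.
Qed.

Lemma learn_ok t c u ds : rules_ok t -> rule_ok c u ds -> rules_ok (learn t c u ds).
Proof.
rewrite /learn => ht hr; have : {subset labs <= labs} by [].
elim: {1 3}labs t ht => [|l ls IH] t ht hs; first by [].
have hl : l \in labs by apply: hs; rewrite inE eqxx.
rewrite [foldl _ _ (l :: ls)](erefl : _ = foldl _ (tset t (c :: relabel u l) (map (unlab l) ds)) ls).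
apply: IH; last by move=> x hx; apply: hs; rewrite inE hx orbT.
move=> c' u' ds' su h; case: (tget_tset h) => [[e ->]|]; last exact: ht.
by case: e => -> ->; apply: rule_relabel.
Qed.
End Rules.

Lemma all_views (os : seq occupancy) (P : pred (seq occupancy)) k u :
  all P (views os k) -> size u = k -> all (fun o => has (eqo o) os) u -> P u.
Proof.
elim: k P u => [|k IH] P [|o u] //=; first by rewrite andbT.
move=> h [su] /andP[ho hu].
apply: (IH (fun u => P (o :: u))) su hu; elim: os {IH} ho (views os k) h => //= o' os IHos.
case: eqoP => [<- _ vs|_ /= ho vs].
  by rewrite /allpairs_dep /= all_cat all_map => /andP[].
by rewrite /allpairs_dep /= all_cat => /andP[_]; apply: IHos.
Qed.

Section Chart.
Variables (g : labelling) (o : point).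

Lemma int_of_Z_succ z : int_of_Z (Z.succ z) = (int_of_Z z + 1)%R.
Proof. lia. Qed.

Lemma int_of_Z_pred z : int_of_Z (Z.pred z) = (int_of_Z z - 1)%R.
Proof. lia. Qed.

Definition axis (d : nat) : point := offset (lab_dir g (inord d)).
(** A symmetry of the grid, rotation or reflection, that places the origin of the search at [o] and
    its axes along the labelling [g]. *)
Definition chart (c : cell) : point :=
  (o.1 + (axis 0).1 * int_of_Z c.1 + (axis 1).1 * int_of_Z c.2,
   o.2 + (axis 0).2 * int_of_Z c.1 + (axis 1).2 * int_of_Z c.2)%R.

Lemma lab_cases (P : labelling -> Prop) :
  (forall l, l \in labs -> P (lab_of l)) -> P g.
Proof.
move=> h; suff -> : g = lab_of (nat_of_ord (lab_start g), lab_reversed g).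
  apply: h; case: g => [[s hs] b] /=.
  by have /allP : all (fun s => (s, true) \in labs) (iota 0 6) by []; 
     have /allP : all (fun s => (s, false) \in labs) (iota 0 6) by [];
     case: b => h1 h2; [apply: h2 | apply: h1]; rewrite mem_iota.
by case: g => s b; rewrite /lab_of /= inord_val.
Qed.

Lemma axisE : exists2 l, l \in labs & forall d, d < 6 ->
  axis d = nth 0%R [:: (1, 0); (0, 1); (-1, 1); (-1, 0); (0, -1); (1, -1)]%R (lab l d).
Proof.
rewrite /axis; apply: (lab_cases (P := fun g => exists2 l, l \in labs & forall d, d < 6 ->
   offset (lab_dir g (inord d)) = _)) => l hl.
by exists l => // k hk; rewrite /offset lab_ofE // inordK.
Qed.

(** Two axes determine the other four and have determinant 1 or -1, which reduces [chart_nbr] and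
    [chart_inj] to linear algebra. The relations are checked for each of the twelve labellings. *)
Lemma axis_rel :
  [/\ axis 2 = (axis 1 - axis 0)%R, axis 3 = (- axis 0)%R, axis 4 = (- axis 1)%R,
      axis 5 = (axis 0 - axis 1)%R &
      ((axis 0).1 * (axis 1).2 - (axis 0).2 * (axis 1).1) ^+ 2 = 1]%R.
Proof.
have [l hl h] := axisE; rewrite !h //.
have /allP H : all (fun l =>
    let a i : point := nth 0 [:: (1, 0); (0, 1); (-1, 1); (-1, 0); (0, -1); (1, -1)] (lab l i) in
    [&& a 2%N == a 1%N - a 0%N, a 3%N == - a 0%N, a 4%N == - a 1%N, a 5%N == a 0%N - a 1%N &
      ((a 0%N).1 * (a 1%N).2 - (a 0%N).2 * (a 1%N).1) ^+ 2 == 1])%R labs by vm_compute.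
by have /and5P[/eqP-> /eqP-> /eqP-> /eqP-> /eqP->] := H _ hl.
Qed.

Lemma chart_nbr c (d : 'I_6) : chart (nbr c d) = (chart c + offset (lab_dir g d))%R.
Proof.
have -> : offset (lab_dir g d) = axis d by rewrite /axis inord_val.
have [e2 e3 e4 e5 _] := axis_rel; case: c => x y; rewrite /chart.
by case: d => -[|[|[|[|[|[|d]]]]]] //= _; rewrite ?e2 ?e3 ?e4 ?e5 ?int_of_Z_succ ?int_of_Z_pred;
  congr pair => /=; ring.
Qed.

Lemma chart_inj : injective chart.
Proof.
move=> [x y] [x' y'] [/=]; have [_ _ _ _ +] := axis_rel.
move: (axis 0) (axis 1) => [a b] [c e] /= hd h1 h2.
set u := (int_of_Z x - int_of_Z x')%R; set v := (int_of_Z y - int_of_Z y')%R.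
have k1 : (a * u + c * v = 0)%R by rewrite /u /v; lia.
have k2 : (b * u + e * v = 0)%R by rewrite /u /v; lia.
(* Cramer's rule, multiplied once more by the determinant, whose square is 1. *)
have ku : ((a * e - b * c) ^+ 2 * u = 0)%R.
  have -> : ((a * e - b * c) ^+ 2 * u = (a * e - b * c) * (e * (a * u + c * v) - c * (b * u + e * v)))%R by ring.
  by rewrite k1 k2; ring.
have kv : ((a * e - b * c) ^+ 2 * v = 0)%R.
  have -> : ((a * e - b * c) ^+ 2 * v = (a * e - b * c) * (a * (b * u + e * v) - b * (a * u + c * v)))%R by ring.
  by rewrite k1 k2; ring.
rewrite hd mul1r in ku; rewrite hd mul1r in kv.
by congr pair; apply: (can_inj int_of_ZK); [move: ku | move: kv]; rewrite /u /v; lia.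
Qed.
End Chart.

Lemma gget_gset gr x o y : gget (gset gr x o) y = if eqc x y then Some o else gget gr y.
Proof.
have zkey_inj a b : zkey a = zkey b -> a = b by case: a => [|p|p]; case: b => [|q|q] //= [->].
case: x y => x1 x2 [y1 y2]; rewrite /gget /gset /= {1}/grow; case: eqcP => [[<- <-]|ne].
  by rewrite PositiveMap.gss PositiveMap.gss.
case: (Z.eq_dec x2 y2) => e2.
  rewrite e2 PositiveMap.gss PositiveMap.gso //.
  by move/zkey_inj => e1; apply: ne; rewrite e1 e2.
by rewrite PositiveMap.gso //; move/zkey_inj => e; apply: e2.
Qed.

(** * Soundness of the search *)

Fixpoint every A (P : A -> Prop) (s : seq A) : Prop :=
  if s is x :: s' then P x /\ every P s' else True.

Lemma every_cat A (P : A -> Prop) s1 s2 : every P s1 -> every P s2 -> every P (s1 ++ s2).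
Proof. by elim: s1 => //= x s1 IH [h1 h2] h; split=> //; apply: IH. Qed.

Lemma every_sub A (P Q : A -> Prop) s : (forall x, P x -> Q x) -> every P s -> every Q s.
Proof. by move=> h; elim: s => //= x s IH [/h h1 /IH h2]. Qed.

Definition no_unit : cell * occupancy := ((Z0, Z0), Empty).
Definition col (us : units) i := (nth no_unit us i).2.

(** This is the clause of [occ] for a unit standing on a cell that may hold further units. *)
Lemma observe_add m k : 0 < m ->
  observe (m + k) = if observe k is Empty then observe m else Multiple.
Proof. by case: m => [|[|m]] // _; case: k => [|[|k]]; rewrite ?addn0 ?addnS. Qed.

Lemma size_set_pos us i x : size (set_pos us i x) = size us.
Proof. by elim: us i => [|[p c] us IH] [|i] //=; rewrite IH. Qed.

Lemma col_set_pos us i x j : col (set_pos us i x) j = col us j.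
Proof. by elim: us i j => [|[p c] us IH] [|i] [|j] //; apply: IH. Qed.

Lemma pos_set_pos us i x j : i < size us ->
  pos (set_pos us i x) j = if j == i then x else pos us j.
Proof. by elim: us i j => [|[p c] us IH] [|i] [|j] //= hi; apply: IH. Qed.

Lemma occ_change (us vs : units) p x y : size vs = size us ->
  (forall j, col vs j = col us j) ->
  (forall j, pos vs j = pos us j \/ (pos us j = p /\ pos vs j = x)) ->
  y <> p -> y <> x -> occ vs y = occ us y.
Proof.
elim: us vs => [|[q c] us IH] [|[q' c'] vs] //= [sz] hc hp yp yx.
rewrite (IH vs) //; try by [move=> j; apply: (hc j.+1) | move=> j; apply: (hp j.+1)].
have := hc 0; have := hp 0; rewrite /pos /col /= => -[->|[-> ->]] -> //.
by case: eqcP => [e|_]; [case: yx | case: eqcP => // e; case: yp].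
Qed.

Lemma occ_unit (us : units) x : occ us x <> Empty -> exists2 i, i < size us & pos us i = x.
Proof.
elim: us => [|[p c] us IH] //=; case: eqcP => [-> _|ne]; first by exists 0.
by case/IH => i hi e; exists i.+1.
Qed.

Lemma unit_atP us x k : match unit_at us x k with
  | Some j => exists2 i, j = k + i & i < size us /\ pos us i = x
  | None => forall i, i < size us -> pos us i <> x end.
Proof.
elim: us k => [|[p c] us IH] k //=; case: eqcP => [<-|ne]; first by exists 0; rewrite ?addn0.
have := IH k.+1; case: (unit_at us x k.+1) => [j [i -> [h1 h2]]|h [|i] //]; last exact: h.
by exists i.+1; rewrite ?addnS.
Qed.

Lemma same_posP us vs : same_pos us vs -> size us = size vs /\ forall i, pos us i = pos vs i.
Proof.
elim: us vs => [|[p c] us IH] [|[q c'] vs] //=.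
by case: eqcP => // -> /IH[-> h]; split=> // -[|i] //; apply: h.
Qed.

Lemma nbr_neq p (d : 'I_6) : nbr p d <> p.
Proof. by case: p => x y; case: d => -[|[|[|[|[|[|d]]]]]] //= _; case; lia. Qed.

Section Soundness.
Variables (n : nat) (alg : algorithm) (C0 : config n).
Notation cfg := {ffun 'I_n -> point}.
Notation reachable := (reachable alg C0).
Notation leads := (@leads n alg).
Hypothesis no_cycle : forall X, reachable X -> ~ leads X X.
Hypothesis meet_start : forall X i j, reachable X -> X i = X j -> C0 i = C0 j.
Hypothesis not_stuck : forall (X : cfg) (l : 'I_n -> labelling), reachable X ->
  exists i, destination alg (conf X) i (l i) != X i.

Variables (g : labelling) (o : point).
Notation chart := (chart g o).
(** [Xr] is the configuration at the root of the search and [low] consists of the robots of its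
    first unit; each other robot can be made to stay there. *)
Variables (paired : bool) (Xr : cfg) (low : {set 'I_n}).
Hypothesis calm : forall a, a \notin low -> exists l, destination alg (conf Xr) a l = Xr a.

Definition block (B : seq {set 'I_n}) i := nth set0 B i.
Definition covered (B : seq {set 'I_n}) a := has (fun b : {set 'I_n} => a \in b) B.

Lemma coveredP B a : reflect (exists2 i, i < size B & a \in block B i) (covered B a).
Proof. exact: (iffP (has_nthP set0)). Qed.

(* The robots outside the blocks have not moved since [Xr]; [B] lists the robots
   of the units of the search. *)
Definition clear B x := forall a, ~~ covered B a -> Xr a <> chart x.
Record rep B (X : cfg) (us : units) : Prop := Rep {
  rep_size : size B = size us;
  rep_col : forall i, i < size us -> observe #|block B i| = col us i;
  rep_ne : forall i, i < size us -> col us i <> Empty;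
  rep_pos : forall i a, a \in block B i -> X a = chart (pos us i);
  rep_far : forall a, ~~ covered B a -> X a = Xr a }.
(** [clear] guarantees that a recorded content accounts for all robots on the cell and not only for
    those in units. *)
Definition grid_ok B (us : units) (gr : grid) :=
  (forall x c, gget gr x = Some c -> occ us x = c /\ clear B x) /\
  (forall i, i < size us -> gget gr (pos us i) <> None).
Definition pair_units i j := in_pair paired i && in_pair paired j.
(** The second clause is what makes a meeting of two units contradict [meet_start]. *)
Definition blocks_ok B :=
  (forall i j a, a \in block B i -> a \in block B j -> i = j) /\
  (forall i j a b, i <> j -> a \in block B i -> b \in block B j -> ~~ pair_units i j ->
     C0 a <> C0 b).

Lemma block_size B i a : a \in block B i -> i < size B.
Proof. by rewrite /block ltnNge => h; apply/negP => hs; rewrite nth_default ?inE in h. Qed.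

Lemma block_covered B i a : a \in block B i -> covered B a.
Proof. by move=> h; apply/coveredP; exists i => //; apply: block_size h. Qed.

Lemma rep_block B X us i : rep B X us -> i < size us -> exists a, a \in block B i.
Proof.
move=> r hi; have := rep_col r hi; have := rep_ne r hi.
by case: (set_0Vmem (block B i)) => [->|[a ha]]; [rewrite cards0 => h1 h2; case: h1; rewrite -h2 | exists a].
Qed.

Lemma occ_rep B X us x : rep B X us -> blocks_ok B -> clear B x ->
  observe (robots_at (conf X) (chart x)) = occ us x.
Proof.
move=> r [dj _] cl.
have -> : robots_at (conf X) (chart x) = #|[set a | covered B a && (X a == chart x)]|.
  apply: eq_card => a; rewrite !inE /conf; case: (boolP (covered B a)) => //= h.
  by rewrite (rep_far r h); apply/eqP/cl.
have {cl r} : [/\ size B = size us, forall i, i < size us -> observe #|block B i| = col us i,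
    forall i, i < size us -> col us i <> Empty &
    forall i a, a \in block B i -> X a = chart (pos us i)] by case: r.
elim: us B dj => [|[p c] us IH] [|b B] dj [] //= => [|[sz] hc hn hp].
  by rewrite (_ : [set a | _] = set0) ?cards0 //; apply/setP => a; rewrite !inE.
have {IH} := IH B (fun i j a hi hj => succn_inj (dj i.+1 j.+1 a hi hj)).
have tl : [/\ size B = size us, forall i, i < size us -> observe #|block B i| = col us i,
    forall i, i < size us -> col us i <> Empty & forall i a, a \in block B i -> X a = chart (pos us i)].
  by split=> // i; [apply: (hc i.+1) | apply: (hn i.+1) | apply: (hp i.+1)].
move/(_ tl) => IH.
set S := [set a | _]; set S' := [set a | covered B a && _] in IH.
have hb a : a \in b -> ~~ covered B a.
  by move=> ha; apply/negP => /coveredP[i hi h]; have := dj 0 i.+1 a ha h.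
have hb0 : 0 < #|b|.
  by have := hn 0 isT; have := hc 0 isT; rewrite /block /=; case: #|b| => //= <-.
case: eqcP => [e|ne].
  have -> : S = b :|: S'.
    apply/setP => a; rewrite !inE /=; case: (boolP (a \in b)) => //= ha.
    by have := hp 0 a ha; rewrite -e /pos /= => ->; rewrite eqxx.
  have dis : b :&: S' = set0.
    by apply/setP => a; rewrite !inE; case: (boolP (a \in b)) => //= /hb/negbTE->.
  rewrite cardsU dis cards0 subn0 observe_add // IH.
  by have := hc 0 isT; rewrite /block /= => ->.
have -> : S = S'; last by [].
apply/setP => a; rewrite !inE /=; case: (boolP (a \in b)) => //= ha.
rewrite (negbTE (hb a ha)) /=; have := hp 0 a ha; rewrite /pos /= => ->.
by apply/eqP => /chart_inj.
Qed.

Section InWorld.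
Variables (B : seq {set 'I_n}) (W : world).
Hypothesis okB : blocks_ok B.
Hypothesis okR : rules_ok alg (alg_rules W).
Hypothesis okC : closed W -> forall a, covered B a.
Hypothesis rep_root : rep B Xr (us (root W)).
Hypothesis okF : full W -> forall i (d : 'I_6), i < size (us (root W)) ->
  clear B (nbr (pos (us (root W)) i) d).
Hypothesis low_block : block B 0 = low.
Hypothesis okP : paired -> 1 < size B.

Lemma known_ok us gr x c : (forall i, i < size us -> gget gr (pos us i) <> None) ->
  grid_ok B us gr -> known W gr x = Some c -> occ us x = c /\ clear B x.
Proof.
move=> hp [hg _]; rewrite /known; case e: (gget gr x) => [c'|]; first by case=> <-; apply: hg.
case cl: (closed W) => // -[<-]; split; last by move=> a; rewrite okC.
case: (occ us x) (@occ_unit us x) => // h; case: h => // i hi ei; by case: (hp i hi); rewrite ei.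
Qed.

Definition seen_from us p (u : seq occupancy) :=
  size u = 6 /\ forall d : 'I_6, occ us (nbr p d) = nth Empty u d /\ clear B (nbr p d).

Lemma view_ok us gr p u : grid_ok B us gr -> view_from W gr p six = inr u -> seen_from us p u.
Proof.
move=> hg; have kn := fun x c => known_ok (c := c) (x := x) (proj2 hg) hg.
have aux ds v : view_from W gr p ds = inr v -> size v = size ds /\
    forall k, k < size ds -> occ us (nbr p (nth 0 ds k)) = nth Empty v k /\ clear B (nbr p (nth 0 ds k)).
  elim: ds v => [|d ds IH] v /=; first by case=> <-.
  case ek: (known W gr (nbr p d)) => [c|] //; case ev: (view_from W gr p ds) => [//|v'] [<-].
  have [sz h] := IH _ ev; split; first by rewrite /= sz.
  by case=> [|k] hk /=; [apply: kn | apply: h].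
move/aux => [sz h]; split=> // d; have := h d (ltn_ord d).
suff -> : nth 0 six d = d by [].
by move: (ltn_ord d); move: (nat_of_ord d); do 6?[case=> //].
Qed.

Lemma here_ok us gr p : grid_ok B us gr -> gget gr p <> None ->
  here gr p = occ us p /\ clear B p.
Proof. by case=> hg _; rewrite /here; case e: (gget gr p) => [c|] // _; have [<-] := hg _ _ e. Qed.

Lemma look_ok X us p u l : rep B X us -> clear B p -> seen_from us p u ->
  look (conf X) (chart p) (lab_comp g l) = view_of (occ us p) u l.
Proof.
move=> r cp [sz h]; congr View; first exact: (occ_rep r okB cp).
apply/ffunP => j; rewrite !ffunE lab_dir_comp -chart_nbr.
by have [<- cl] := h (lab_dir l j); apply: (occ_rep r okB cl).
Qed.

Lemma dest_possible X us p u (d : 'I_6) : rep B X us -> clear B p -> seen_from us p u ->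
  possible alg (occ us p) u d ->
  exists l, forall a, X a = chart p -> destination alg (conf X) a l = chart (nbr p d).
Proof.
move=> r cp sf [l [j [h hd]]]; exists (lab_comp g l) => a ha.
have e : conf X a = chart p := ha.
rewrite /destination e (look_ok _ r cp sf) h lab_dir_comp -chart_nbr.
by congr (chart (nbr p _)).
Qed.

Lemma dest_stayable X us p u : rep B X us -> clear B p -> seen_from us p u ->
  stayable alg (occ us p) u ->
  exists l, forall a, X a = chart p -> destination alg (conf X) a l = X a.
Proof.
move=> r cp sf [l h]; exists (lab_comp g l) => a ha.
have e : conf X a = chart p := ha.
by rewrite /destination e (look_ok _ r cp sf) h ha.
Qed.

(** Robots at the same point with the same labelling have the same destination. [M] need not contain
    all robots of the point, so one robot or one half of a joined pair can also be moved alone. *)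
Lemma push X (M : {set 'I_n}) p x a0 l : reachable X -> a0 \in M -> x <> p ->
  (forall a, a \in M -> X a = chart p) ->
  (forall a, X a = chart p -> destination alg (conf X) a l = chart x) ->
  exists Y, [/\ reachable Y, leads X Y &
    forall a, Y a = if a \in M then chart x else X a].
Proof.
move=> rX ha xp hM hd; exists (step alg X (M, fun=> l)).
have M0 : M != set0 by apply/set0Pn; exists a0.
have YE a : step alg X (M, fun=> l) a = if a \in M then chart x else X a.
  by rewrite ffunE /=; case: ifP => // /hM /hd.
split=> //; first exact: reachable_step.
apply: leads_step => //; apply/eqP => /ffunP/(_ a0); rewrite YE ha (hM _ ha).
by move/chart_inj.
Qed.

Lemma target X us gr i xs x : rep B X us -> grid_ok B us gr -> i < size us ->
  status_of W gr (pos us i) = Go xs -> has (eqc x) xs ->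
  [/\ x <> pos us i, clear B x & exists l, forall a, X a = chart (pos us i) ->
      destination alg (conf X) a l = chart x].
Proof.
move=> r hg hi; rewrite /status_of; case ev: (view_from _ _ _ _) => [//|u].
have sf := view_ok hg ev; have [eh cp] := here_ok hg ((proj2 hg) i hi).
case et: (tget _ _) => [ds|] // [<-]; rewrite has_map => /hasP[d hd] /eqcP ->.
have := okR (proj1 sf) et; rewrite /rule_ok; case: ds hd {et} => // d' ds hd [_ /(_ _ hd) pd].
have d6 := possible_lt pd; rewrite eh in pd.
have [_ cx] := (proj2 sf) (Ordinal d6).
by split=> //; [exact: (@nbr_neq _ (Ordinal d6)) | exact: (dest_possible (d := Ordinal d6) r cp sf pd)].
Qed.

(** A single robot of unit [i] is moved onto unit [j], where it meets a robot with another starting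
    point. *)
Lemma no_collision X us i j l : reachable X -> rep B X us -> i < size us -> j < size us ->
  pos us j <> pos us i -> ~~ pair_units i j ->
  (forall a, X a = chart (pos us i) -> destination alg (conf X) a l = chart (pos us j)) -> False.
Proof.
move=> rX r hi hj ne np hd; have [a ha] := rep_block r hi; have [b hb] := rep_block r hj.
have [||Y [rY _ YE]] := @push X [set a] (pos us i) (pos us j) a l rX _ ne _ hd; first by rewrite inE.
  by move=> a'; rewrite inE => /eqP->; exact: (rep_pos r ha).
have ij : i <> j by move=> e; apply: ne; rewrite e.
have ab : b != a by apply/eqP => e; apply: ij; apply: ((proj1 okB) _ _ _ ha); rewrite -e.
apply: ((proj2 okB) i j a b ij ha hb np); apply: (meet_start rY).
by rewrite !YE !inE eqxx (negbTE ab) (rep_pos r hb).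
Qed.

Definition good X st (m : move) := exists Y,
  [/\ reachable Y, leads X Y, rep B Y m.1 & grid_ok B m.1 (gr (relocate (gr st) m))].

Lemma relocate_ok us g0 vs p x i0 : grid_ok B us g0 -> i0 < size us -> pos us i0 = p ->
  clear B x ->
  size vs = size us -> (forall j, col vs j = col us j) ->
  (forall j, pos vs j = pos us j \/ (pos us j = p /\ pos vs j = x)) ->
  grid_ok B vs (gr (relocate g0 (vs, (p, x)))).
Proof.
move=> [hg hp] hi0 e0 cx sz hc hv; rewrite /relocate /=; split.
  move=> y c; rewrite !gget_gset; case: eqcP => [<- [<-]|yx] //.
  case: eqcP => [<- [<-]|yp].
    split=> //; have := hp _ hi0; rewrite e0; case e: (gget g0 p) => [c'|] // _.
    by have [] := hg _ _ e.
  by move/hg => [<- ?]; split=> //; apply: (occ_change sz hc hv); [move=> e; apply: yp | move=> e; apply: yx].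
move=> i; rewrite sz => hi; rewrite !gget_gset; case: eqcP => // nx; case: eqcP => // np.
by case: (hv i) => [->|[_ e]]; [apply: hp | case: nx].
Qed.

Lemma good_alone X us gr i xs x : reachable X -> rep B X us -> grid_ok B us gr -> i < size us ->
  status_of W gr (pos us i) = Go xs -> has (eqc x) xs ->
  good X (State us gr) (set_pos us i x, (pos us i, x)).
Proof.
move=> rX r hg hi es hx; have [xp cx [l hl]] := target r hg hi es hx.
have [a0 ha0] := rep_block r hi.
have [Y [rY lY YE]] := push rX ha0 xp (fun a ha => rep_pos r ha) hl.
exists Y; split=> //=; first split.
- by rewrite size_set_pos (rep_size r).
- by move=> j; rewrite size_set_pos col_set_pos; apply: (rep_col r).
- by move=> j; rewrite size_set_pos col_set_pos; apply: (rep_ne r).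
- move=> j a ha; rewrite YE pos_set_pos //; case: (j =P i) => [<-|ne]; first by rewrite ha.
  by case: ifP => [h|_]; [case: ne; exact: ((proj1 okB) _ _ _ ha h) | exact: (rep_pos r ha)].
- move=> a na; rewrite YE; case: ifP => [h|_]; last exact: (rep_far r).
  by move: na; rewrite (block_covered h).
- apply: (relocate_ok hg hi) => // [|j|j]; rewrite ?size_set_pos ?col_set_pos //.
  by rewrite pos_set_pos //; case: eqP => [->|]; [right | left].
Qed.

Lemma good_both X us gr xs x : reachable X -> rep B X us -> grid_ok B us gr ->
  0 < size us -> 1 < size us -> pos us 0 = pos us 1 ->
  status_of W gr (pos us 0) = Go xs -> has (eqc x) xs ->
  good X (State us gr) (set_pos (set_pos us 0 x) 1 x, (pos us 0, x)).
Proof.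
move=> rX r hg h0 h1 e01 es hx; have [xp cx [l hl]] := target r hg h0 es hx.
have [a0 ha0] := rep_block r h0.
have hM a : a \in block B 0 :|: block B 1 -> X a = chart (pos us 0).
  by rewrite inE => /orP[/(rep_pos r)//|/(rep_pos r) ->]; rewrite e01.
have ha0' : a0 \in block B 0 :|: block B 1 by rewrite inE ha0.
have [Y [rY lY YE]] := push rX ha0' xp hM hl.
have pE j : pos (set_pos (set_pos us 0 x) 1 x) j = if (j == 1) || (j == 0) then x else pos us j.
  by rewrite pos_set_pos ?size_set_pos // pos_set_pos //; case: eqP.
exists Y; split=> //=; first split.
- by rewrite !size_set_pos (rep_size r).
- by move=> j; rewrite !size_set_pos !col_set_pos; apply: (rep_col r).
- by move=> j; rewrite !size_set_pos !col_set_pos; apply: (rep_ne r).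
- move=> j a ha; rewrite YE pE inE; case: ifP => [|h].
    by case/orP => h; rewrite ((proj1 okB) _ _ _ ha h) //= orbT.
  case: eqP => [ej|_] /=; first by rewrite ej in ha; rewrite ha orbT in h.
  case: eqP => [ej|_] /=; first by rewrite ej in ha; rewrite ha in h.
  exact: (rep_pos r ha).
- move=> a na; rewrite YE inE; case: ifP => [|_]; last exact: (rep_far r).
  by case/orP => /block_covered h; move: na; rewrite h.
- apply: (relocate_ok hg h0) => // [|j|j]; rewrite ?size_set_pos ?col_set_pos //.
  by rewrite pE; case: eqP => [->|_]; [rewrite -e01; right | case: eqP => [->|_]; [right | left]].
Qed.

Lemma moves_to_ok X us gr i xs x : reachable X -> rep B X us -> grid_ok B us gr ->
  i < size us -> status_of W gr (pos us i) = Go xs -> has (eqc x) xs ->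
  if moves_to paired (State us gr) i x is Some ms then every (good X (State us gr)) ms else False.
Proof.
move=> rX r hg hi es hx; have gd := good_alone rX r hg hi es hx.
rewrite /moves_to /=; have := unit_atP us x 0; case: (unit_at us x 0) => [j [k ek [hk pk]]|_].
  rewrite add0n in ek; subst k.
  case e: (if in_pair paired i then _ else _) => //=.
  have [xp _ [l hl]] := target r hg hi es hx.
  apply: (@no_collision X us i j l) => //; rewrite ?pk //.
  by rewrite /pair_units; move: e; case: (in_pair paired i) => // ->.
case e: (if in_pair paired i then _ else _) => //=.
case: i hi es e gd => [|i] hi es e gd //=; split=> //.
move: e; rewrite /in_pair /joined; case ep: paired => //= /eqcP e01.
have h1 : 1 < size us by rewrite -(rep_size r); apply: okP.
exact: good_both rX r hg hi h1 e01 es hx.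
Qed.

Lemma unit_moves_ok X us gr i xs : reachable X -> rep B X us -> grid_ok B us gr ->
  i < size us -> status_of W gr (pos us i) = Go xs ->
  if unit_moves paired (State us gr) i xs is Some ms then every (good X (State us gr)) ms else False.
Proof.
move=> rX r hg hi es; have : forall x, has (eqc x) xs -> has (eqc x) xs by [].
elim: {1 3}xs => //= x xs' IH hs.
have := moves_to_ok rX r hg hi es (hs x _); case: (eqcP x x) => // _ /(_ isT).
case: (moves_to _ _ _ _) => // ms h1.
have /IH : forall y, has (eqc y) xs' -> has (eqc y) xs by move=> y hy; apply: hs; rewrite /= hy orbT.
case: (unit_moves _ _ _ _) => // ms'; exact: every_cat.
Qed.

Definition statuses_from us gr i (ss : seq status) :=
  i + size ss = size us /\
  forall k, k < size ss -> nth (Go [::]) ss k = status_of W gr (pos us (i + k)).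

Lemma statuses_ok us gr : statuses_from us gr 0 (statuses W (State us gr)).
Proof.
by split=> [|k]; rewrite ?add0n /statuses size_map //= => hk; rewrite (nth_map no_unit).
Qed.

Lemma statuses_behead us gr i s ss : statuses_from us gr i (s :: ss) ->
  [/\ i < size us, status_of W gr (pos us i) = s & statuses_from us gr i.+1 ss].
Proof.
case=> /= sz h; split; first lia.
  by have := h 0 isT; rewrite addn0.
by split=> [|k hk]; [lia | have := h k.+1 hk; rewrite addnS addSn].
Qed.

Lemma all_moves_ok X us gr i ss : reachable X -> rep B X us -> grid_ok B us gr ->
  statuses_from us gr i ss ->
  if all_moves paired (State us gr) i ss is Some ms then every (good X (State us gr)) ms else False.
Proof.
move=> rX r hg; elim: ss i => [|s ss IH] i //= /statuses_behead[hi es /IH].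
case: s es => [w|xs] es //; have := unit_moves_ok rX r hg hi es.
case: (unit_moves _ _ _ _) => // ms h1; case: (all_moves _ _ _ _) => // ms' h2.
exact: every_cat.
Qed.

(** One robot of each unit is activated in the same round, with the labelling that sends it to the
    common cell. *)
Lemma no_clash X us gr i j xs ys : reachable X -> rep B X us -> grid_ok B us gr ->
  i < size us -> j < size us -> i < j -> ~~ pair_units i j ->
  status_of W gr (pos us i) = Go xs -> status_of W gr (pos us j) = Go ys ->
  has (fun x => has (eqc x) ys) xs -> False.
Proof.
move=> rX r hg hi hj ij np ex ey /hasP/= hx.
have [x hx1 hx2] : exists2 x, has (eqc x) xs & has (eqc x) ys.
  by case: hx => x hx hy; exists x => //; apply/hasP; exists x => //; apply/eqcP.
have [_ _ [l1 h1]] := target r hg hi ex hx1; have [_ _ [l2 h2]] := target r hg hj ey hx2.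
have [a ha] := rep_block r hi; have [b hb] := rep_block r hj.
have nij : i <> j by lia.
have ab : b != a by apply/eqP => e; apply: nij; apply: ((proj1 okB) _ _ _ ha); rewrite -e.
pose rd : {set 'I_n} * ('I_n -> labelling) := ([set a; b], fun c => if c == a then l1 else l2).
have rY : reachable (step alg X rd).
  by apply: reachable_step => //; apply/set0Pn; exists a; rewrite !inE eqxx.
apply: ((proj2 okB) i j a b nij ha hb np); apply: (meet_start rY).
rewrite !ffunE /= !inE !eqxx orbT (negbTE ab) /= h1 ?h2 //; exact: (rep_pos r).
Qed.

Lemma clash_no X us gr i xs j ss : reachable X -> rep B X us -> grid_ok B us gr ->
  i < size us -> status_of W gr (pos us i) = Go xs -> i < j -> statuses_from us gr j ss ->
  clash paired i xs j ss -> False.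
Proof.
move=> rX r hg hi ex; elim: ss j => [|s ss IH] j //= ij /statuses_behead[hj ey h].
case: ifP => [e _|_]; last by apply: IH h; lia.
case: s ey e => // ys ey; case ep: (if in_pair paired i then _ else _) => // hx.
apply: (no_clash rX r hg hi hj ij _ ex ey hx).
by rewrite /pair_units; move: ep; case: (in_pair paired i) => // ->.
Qed.

Lemma clashes_no X us gr i ss : reachable X -> rep B X us -> grid_ok B us gr ->
  statuses_from us gr i ss -> clashes paired i ss -> False.
Proof.
move=> rX r hg; elim: ss i => [|s ss IH] i //= /statuses_behead[hi ex h].
case: ifP => [e _|_]; last exact: IH h.
case: s ex e => // -[|x xs] // ex; exact: (clash_no rX r hg hi ex (ltnSn i) h).
Qed.

(** The invariant of the questions: because occupied directions are impossible, the orbits of empty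
    directions exhaust the ways in which a robot that cannot stay may move. *)
Definition want_ok (w : want) :=
  if w is Rule c u then size u = 6 /\ forall d, nth Empty u d <> Empty -> ~ possible alg c u d
  else True.

Lemma rule_want X us gr i c u : reachable X -> rep B X us -> grid_ok B us gr -> i < size us ->
  status_of W gr (pos us i) = Unknown (Rule c u) -> ~~ (parted paired us && in_pair paired i) ->
  want_ok (Rule c u).
Proof.
move=> rX r hg hi; rewrite /status_of; case ev: (view_from _ _ _ _) => [//|v].
have sf := view_ok hg ev; have [eh cp] := here_ok hg ((proj2 hg) i hi).
case: (tget _ _) => // -[<- <-] hp; split=> [|d nd pd]; first exact: (proj1 sf).
have d6 := possible_lt pd; rewrite eh in pd.
have [ed _] := (proj2 sf) (Ordinal d6); rewrite /= in ed.
have [j hj ej] : exists2 j, j < size us & pos us j = nbr (pos us i) d.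
  by apply: occ_unit; rewrite ed.
have [l hl] := dest_possible (d := Ordinal d6) r cp sf pd.
have ne : pos us j <> pos us i by rewrite ej; apply: (@nbr_neq _ (Ordinal d6)).
apply: (no_collision (l := l) rX r hi hj ne) => [|a ha]; last by rewrite ej hl.
(* If both units belonged to the pair, the pair would be joined, whereas the two units occupy
   adjacent cells. *)
apply/negP => /andP[pi pj]; move: hp; rewrite pi andbT /parted /joined.
move: (pi) (pj); rewrite /in_pair; case: paired => //= i2 j2.
suff -> : eqc (pos us 0) (pos us 1) = false by [].
by apply/eqcP => e; apply: ne; case: i j i2 j2 {hi hj ej hl pi pj ev pd ed cp sf eh} => [|[|i]] [|[|j]].
Qed.

Lemma wants_ok X us gr first i ss ws : reachable X -> rep B X us -> grid_ok B us gr ->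
  statuses_from us gr i ss -> every want_ok ws ->
  every want_ok (wants paired first us i ss ws).
Proof.
move=> rX r hg; elim: ss i ws => [|s ss IH] i ws //= /statuses_behead[hi ex h] hw.
apply: IH h _; case: s ex => [w|//] ex.
have add : ~~ (parted paired us && in_pair paired i) -> every want_ok (add_want w ws).
  move=> hp; rewrite /add_want; case: ifP => // _; split=> //.
  by case: w ex => // c u ex; apply: (rule_want rX r hg hi ex).
case ep: (parted paired us) in add *; last exact: add.
case: first => //; case: w ex add => [x|c u] ex add /=.
  by rewrite /add_want; case: ifP.
by case: (in_pair paired i) in add *; [| apply: add].
Qed.
Lemma offset_opp (e : 'I_6) : exists e', offset e' = (- offset e)%R.
Proof.
by case: e => -[|[|[|[|[|[|e]]]]]] //= h; [exists (@Ordinal 6 3 isT) | exists (@Ordinal 6 4 isT)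
  | exists (@Ordinal 6 5 isT) | exists (@Ordinal 6 0 isT) | exists (@Ordinal 6 1 isT) | exists (@Ordinal 6 2 isT)].
Qed.

Lemma chart_near p q e : chart p = (q + offset e)%R -> exists d : 'I_6, q = chart (nbr p d).
Proof.
move=> h; have [e' he] := offset_opp e; exists (lab_dir (lab_inv g) e').
by rewrite chart_nbr lab_invKV he h addrK.
Qed.

Hypothesis okG : grid_ok B (us (root W)) (gr (root W)).

(** A robot outside the units has no robot of a unit within distance one, in [Xr] by fullness and in
    [X] because the cells around the units are known and clear. So it sees what it saw in [Xr],
    where it can stay; together with the staying units this contradicts [not_stuck]. *)
Lemma stuck X us gr : reachable X -> rep B X us -> grid_ok B us gr -> full W ->
  all_stay (statuses W (State us gr)) -> False.
Proof.
move=> rX r hg fW /all_nthP st.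
have hs i : i < size us -> exists2 u, seen_from us (pos us i) u &
    stayable alg (occ us (pos us i)) u /\ clear B (pos us i).
  move=> hi; have := st (Go [::]) i; rewrite /statuses size_map (nth_map no_unit) //= => /(_ hi).
  rewrite -/(pos us i) /status_of; case ev: (view_from _ _ _ _) => [//|u].
  have sf := view_ok hg ev; have [eh cp] := here_ok hg ((proj2 hg) i hi).
  by case et: (tget _ _) => [[|d ds]|] // _; exists u => //; have := okR (proj1 sf) et; rewrite eh.
have near us' Y a q : rep B Y us' -> (forall i, i < size us' -> clear B (pos us' i) /\
      forall d : 'I_6, clear B (nbr (pos us' i) d)) ->
    ~~ covered B a -> (q = Xr a \/ exists e, q = (Xr a + offset e)%R) ->
    forall b, covered B b -> Y b <> q.
  move=> rY cl na hq b /coveredP[i hi hb]; rewrite (rep_pos rY hb).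
  rewrite (rep_size rY) in hi; have [c1 c2] := cl i hi.
  case: hq => [->|[e ->]]; first by move/esym; apply: c1.
  by move/chart_near => [d]; apply: c2.
have same a q : ~~ covered B a -> (q = Xr a \/ exists e, q = (Xr a + offset e)%R) ->
    robots_at (conf X) q = robots_at (conf Xr) q.
  move=> na hq; apply: eq_card => b; rewrite !inE /conf.
  case: (boolP (covered B b)) => hb; last by rewrite (rep_far r hb).
  have h1 : X b <> q.
    apply: (near us X a q r _ na hq b hb) => i /hs[u sf [_ cp]]; split=> // d.
    by have [] := (proj2 sf) d.
  have h2 : Xr b <> q.
    apply: (near _ Xr a q rep_root _ na hq b hb) => i hi; split=> [|d]; last exact: okF.
    by have [] := here_ok okG ((proj2 okG) i hi).
  by rewrite (introF eqP h1) (introF eqP h2).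
have [l hl] : exists l : 'I_n -> labelling, forall a, destination alg (conf X) a (l a) = X a.
  apply: (@fin_all_exists _ _ (fun a l => destination alg (conf X) a l = X a)) => a.
  case: (boolP (covered B a)) => [/coveredP[i hi ha]|na].
    rewrite (rep_size r) in hi; have [u sf [sy cp]] := hs i hi.
    by have [l hl] := dest_stayable r cp sf sy; exists l; apply: hl; apply: (rep_pos r ha).
  have al : a \notin low.
    by rewrite -low_block; apply/negP => /block_covered h; rewrite h in na.
  have [l hl] := calm al; exists l.
  have e : look (conf X) (conf X a) l = look (conf Xr) (conf Xr a) l.
    rewrite /conf (rep_far r na); congr View; first by rewrite (same a) //; left.
    by apply/ffunP => j; rewrite !ffunE (same a) //; right; eexists.
  by move: hl; rewrite /destination e /conf (rep_far r na).
by have [a] := not_stuck l rX; rewrite hl eqxx.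
Qed.

Lemma rep_same X Y us vs : rep B X us -> rep B Y vs -> same_pos us vs -> X = Y.
Proof.
move=> rX rY /same_posP[_ e]; apply/ffunP => a.
case: (boolP (covered B a)) => [/coveredP[i _ ha]|na]; last by rewrite (rep_far rX na) (rep_far rY na).
by rewrite (rep_pos rX ha) (rep_pos rY ha) e.
Qed.

Definition trail X path :=
  every (fun vs => exists X', [/\ reachable X', leads X' X & rep B X' vs]) path.

Lemma trail_visited X us path : rep B X us -> trail X path -> visited us path -> False.
Proof.
move=> r; elim: path => //= vs path IH [[X' [h1 h2 h3]] h]; case: ifP => [e _|_]; last exact: IH.
by apply: (no_cycle h1); move: h2; rewrite (rep_same r h3 e).
Qed.

Lemma trail_step X Y us path : reachable X -> leads X Y -> rep B X us -> trail X path ->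
  trail Y (us :: path).
Proof.
move=> rX lY r tr; split; first by exists X.
apply: every_sub tr => vs [X' [h1 h2 h3]]; exists X'; split=> //; exact: leads_trans lY.
Qed.

(** A world that describes the real situation is never refuted, and its open questions have
    admissible answers only. *)
Definition outcome r := if r is Open ws _ then every want_ok ws else False.

Lemma explore_ok depth first path X st ws seen : reachable X -> rep B X (us st) ->
  grid_ok B (us st) (gr st) -> trail X path -> every want_ok ws ->
  outcome (explore paired W depth first path st ws seen).
Proof.
elim: depth first path X st ws seen => [|depth IH] first path X [us gr] ws seen //= rX r hg tr hw.
case: ifP => [|_]; first by case fW: (full W) => // /(stuck rX r hg fW).
case: ifP => [/(clashes_no rX r hg (statuses_ok us gr))|_] //.
have := all_moves_ok rX r hg (statuses_ok us gr); case: (all_moves _ _ _ _) => // ms.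
set r0 := Open _ _.
have : outcome r0 by apply: (wants_ok _ rX r hg (statuses_ok us gr)).
move: r0; elim: ms => [|m ms IHm] r0 h0 //= [[Y [rY lY repY gY]] hms]; apply: IHm => //.
case: r0 h0 => // ws' seen' h0; have tY := trail_step rX lY r tr.
case: ifP => [/(trail_visited repY tY)|_] //; case: ifP => // _.
by apply: (IH _ _ Y) => //; case: m repY gY => vs [p x].
Qed.
End InWorld.

(** * Soundness of the case distinctions on cells and rules *)

Variables (mate : {set 'I_n}) (tab : trie (seq (seq nat))) (max_units : nat) (stacks : bool).
Hypothesis reachable_root : reachable Xr.
Hypothesis n_le6 : n <= 6.
Hypothesis kept : forall a b, C0 a = C0 b ->
  Xr a = Xr b \/ [/\ paired, a \in low :|: mate & b \in low :|: mate].
Hypothesis few : size (undup (codom Xr)) <= max_units.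
Hypothesis stackable : stacks \/ injective Xr.
Hypothesis tab_ok : forall u d, size u = 6 -> d < 6 -> nth Empty u d = Empty ->
  exists2 os, os \in options tab u & d \in os /\ {subset os <= dir_orbit u d}.

Record ready B (R : state) (t : rules) : Prop := Ready {
  rd_blocks : blocks_ok B;
  rd_rep : rep B Xr (us R);
  rd_grid : grid_ok B (us R) (gr R);
  rd_rules : rules_ok alg t;
  rd_low : 0 < size B /\ block B 0 = low;
  rd_pair : paired -> block B 1 = mate /\ 1 < size B;
  rd_uniq : uniq [seq chart e.1 | e <- us R] }.
Definition sound B W := [/\ ready B (root W) (alg_rules W), closed W -> forall a, covered B a &
  full W -> forall i (d : 'I_6), i < size (us (root W)) -> clear B (nbr (pos (us (root W)) i) d)].

Lemma explore_sound B W : sound B W ->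
  outcome (explore paired W 10 true [::] (root W) [::] [::]).
Proof.
case=> -[h1 h2 h3 h4 [_ h5] h6 h7] h8 h9.
apply: (@explore_ok B W) => //.
all: first [by move/h6 => [] | exact: h2 | exact: h3 | exact: reachable_root | exact: I].
Qed.

Lemma calm_stay B W i u : sound B W -> 0 < i -> i < size (us (root W)) ->
  view_from W (gr (root W)) (pos (us (root W)) i) six = inr u ->
  size u = 6 /\ stayable alg (here (gr (root W)) (pos (us (root W)) i)) u.
Proof.
case=> -[h1 h2 h3 h4 [_ h5] h6 h7] h8 h9 i0 hi ev.
have sf := view_ok h8 h3 ev; split; first exact: (proj1 sf).
have [-> cp] := here_ok h3 ((proj2 h3) i hi).
have [a ha] := rep_block h2 hi.
have al : a \notin low.
  by rewrite -h5; apply/negP => /((proj1 h1) _ _ _ ha) e; rewrite e in i0.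
have [l] := calm al; rewrite /destination /conf (rep_pos h2 ha) => hl.
exists (lab_comp (lab_inv g) l); rewrite -(look_ok h1 _ h2 cp sf).
have -> : look (conf Xr) (chart (pos (us (root W)) i)) (lab_comp g (lab_comp (lab_inv g) l)) =
          look (conf Xr) (chart (pos (us (root W)) i)) l.
  by congr View; apply/ffunP => j; rewrite !ffunE !lab_dir_comp lab_invKV.
(* No offset is zero, so a robot that remains in place was told to stay. *)
move: hl; rewrite /conf; case: (alg _) => // j; rewrite -[RHS]addr0 => /addrI.
by case: (lab_dir l j) => -[|[|[|[|[|[|d]]]]]].
Qed.

Lemma settle_ok B W k : 0 < k -> sound B W ->
  if settle W (drop k (us (root W))) is Some W' then sound B W' else False.
Proof.
move e: (drop k (us (root W))) => vs; elim: vs k W e => [|[p c] vs IH] k W e k0 sW //.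
have hk : k < size (us (root W)) by rewrite ltnNge; apply/negP => h; rewrite drop_oversize in e.
move: e; rewrite (drop_nth no_unit) // => -[en ed].
have ep : pos (us (root W)) k = p by rewrite /pos en.
rewrite /settle -/settle; case ev: (view_from _ _ _ _) => [x|u]; first exact: (IH k.+1).
have [su st] := calm_stay sW k0 hk (etrans (congr1 (fun p => view_from W _ p six) ep) ev).
rewrite ep in st; case: (sW) => rd hc hf.
case et: (tget _ _) => [[|d ds]|]; first exact: (IH k.+1).
  by have [] := rd_rules rd su et.
apply: (IH k.+1) => //; split=> //; case: rd => *; split=> //=; exact: learn_ok.
Qed.

Lemma weight_ok B X us : blocks_ok B -> rep B X us -> weight us <= #|[set a | covered B a]|.
Proof.
case=> dj _ [sz hc hn _ _].
elim: us B dj sz hc hn => [|[p c] us IH] [|b B] dj //= [sz] hc hn.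
have {IH} := IH B (fun i j a hi hj => succn_inj (dj i.+1 j.+1 a hi hj)) sz
  (fun i => hc i.+1) (fun i => hn i.+1).
have -> : [set a | covered (b :: B) a] = b :|: [set a | covered B a].
  by apply/setP => a; rewrite !inE.
have dis : b :&: [set a | covered B a] = set0.
  apply/setP => a; rewrite !inE; apply/negP => /andP[ha /coveredP[i hi h]].
  by have := dj 0 i.+1 a ha h.
rewrite cardsU dis cards0 subn0 => h; apply: leq_add => //.
have := hc 0 isT; have := hn 0 isT; rewrite /block /col /= => n0 e.
by move: n0; rewrite -e; case: #|b| => [|[|m]].
Qed.

(** A robot outside the units stands on a point that no unit occupies, since the cells of units are
    clear; hence it adds one to both counts. *)
Lemma budget B R t (more : bool) : ready B R t -> (more -> exists a, ~~ covered B a) ->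
  more + size (us R) <= max_units /\ more + weight (us R) <= 6.
Proof.
case=> h1 h2 h3 h4 h5 h6 h7 hm; split.
  apply: leq_trans few; have sub : {subset [seq chart e.1 | e <- us R] <= undup (codom Xr)}.
    move=> q /(nthP 0%R)[i]; rewrite size_map => hi; rewrite (nth_map no_unit) // => <-.
    by have [a ha] := rep_block h2 hi; rewrite mem_undup -(rep_pos h2 ha) codom_f.
  case: more hm => [/(_ isT)[a na]|_]; last by rewrite add0n -(size_map (fun e => chart e.1)) uniq_leq_size.
  rewrite -(size_map (fun e => chart e.1)) -[true + _]/(size (Xr a :: [seq chart e.1 | e <- us R])).
  apply: uniq_leq_size => /=; last first.
    by move=> q; rewrite inE => /orP[/eqP->|/sub//]; rewrite mem_undup codom_f.
  rewrite h7 andbT; apply/negP => /(nthP 0%R)[i]; rewrite size_map => hi.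
  rewrite (nth_map no_unit) // => /esym; have [_ cl] := here_ok h3 ((proj2 h3) i hi); exact: cl.
have w := weight_ok h1 h2; apply: leq_trans n_le6.
case: more hm => [/(_ isT)[a na]|_]; last first.
  by apply: leq_trans w _; rewrite -[X in _ <= X]card_ord max_card.
have : [set a | covered B a] \subset [set~ a].
  by apply/subsetP => b; rewrite !inE => hb; apply: contra na => /eqP<-.
move/subset_leq_card; rewrite cardsC1 card_ord => hc.
have := leq_trans w hc; have : 0 < n by case: (n) a {na hc w} => // -[].
rewrite /nat_of_bool; lia.
Qed.

Lemma make_world_ok B R t : ready B R t ->
  if make_world max_units R t is Some W' then sound B W' else False.
Proof.
move=> rd; rewrite /make_world; set W := World _ _ _ _.
have -> : behead (us R) = drop 1 (us (root W)) by rewrite drop1.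
apply: settle_ok => //.
have hc : ~~ can_single max_units (us R) -> forall a, covered B a.
  move=> h a; apply/negPn/negP => na; have [] := budget (more := true) rd (fun _ => ex_intro _ a na).
  by move: h; rewrite /can_single /nat_of_bool; case: ifP; lia.
split=> //= fl i d hi a na; case: (boolP (~~ can_single max_units (us R))) fl => [/hc/(_ a) h|_] /=.
  by rewrite h in na.
move/(all_nthP no_unit) => /(_ i hi) known6.
have /allP : all (fun d => isSome (gget (gr R) (nbr (pos (us R) i) d))) six := known6.
have hd : nat_of_ord d \in six by case: (d) => -[|[|[|[|[|[|e]]]]]].
move/(_ _ hd); case e: (gget _ _) => [c|] // _.
by have [_ cl] := (proj1 (rd_grid rd)) _ _ e; apply: cl.
Qed.

(** The robots found at [x] form a new block. By [kept], robots with a common start are still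
    together in [Xr] unless they belong to the pair, which the blocks already contain; so the new
    block started apart from all others. *)
Lemma reveal_ok B R t x : ready B R t -> gget (gr R) x = None ->
  exists B', ready B' (reveal R x (observe #|[set a | Xr a == chart x]|)) t.
Proof.
case=> h1 h2 h3 h4 [h50 h5] h6 h7 ex; set S := [set a | _].
have far a : a \in S -> ~~ covered B a.
  rewrite inE => /eqP ea; apply/negP => /coveredP[i hi ha].
  rewrite (rep_size h2) in hi; move: ea; rewrite (rep_pos h2 ha) => /chart_inj e.
  by have := (proj2 h3) i hi; rewrite e.
have [S0|S1] := posnP #|S|.
  exists B; rewrite S0; split=> //; split=> /=.
    move=> y c; rewrite gget_gset; case: eqcP => [<-|_]; last exact: (proj1 h3).
    case=> <-; split; last by move=> a _ e; move/cards0_eq: S0 => /setP/(_ a); rewrite !inE e eqxx.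
    by case: (occ (us R) x) (@occ_unit (us R) x) => // -[//|i hi ei]; have := (proj2 h3) i hi; rewrite ei.
  by move=> i hi; rewrite gget_gset; case: eqcP => // _; apply: (proj2 h3).
have -> : reveal R x (observe #|S|) = State (rcons (us R) (x, observe #|S|)) (gset (gr R) x (observe #|S|)).
  by rewrite /reveal; case: #|S| S1 => [|[|m]].
have cov a : covered (rcons B S) a = (a \in S) || covered B a by rewrite /covered has_rcons.
have sz := rep_size h2.
have bE i : block (rcons B S) i = if i < size B then block B i else if i == size B then S else set0.
  exact: nth_rcons.
have pE i : pos (rcons (us R) (x, observe #|S|)) i =
    if i < size B then pos (us R) i else if i == size B then x else (Z0, Z0).
  by rewrite /pos nth_rcons sz; case: ifP => // _; case: ifP.
have cE i : col (rcons (us R) (x, observe #|S|)) i =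
    if i < size B then col (us R) i else if i == size B then observe #|S| else Empty.
  by rewrite /col nth_rcons sz; case: ifP => // _; case: ifP.
have mem i a : a \in block (rcons B S) i -> (a \in block B i /\ i < size B) \/ (a \in S /\ i = size B).
  rewrite bE; case: ifP => [hi ha|_]; first by left.
  by case: eqP => [-> ha|_]; [right | rewrite inE].
have occE y : occ (rcons (us R) (x, observe #|S|)) y = if eqc x y then
    (if occ (us R) y is Empty then observe #|S| else Multiple) else occ (us R) y.
  have := rep_ne h2; elim: (us R) => [|[p c] vs IH] /= hn; first by case: eqcP.
  rewrite (IH (fun i => hn i.+1)); case: (eqcP p y) => //; case: (eqcP x y) => // _ _.
  have := hn 0 isT; rewrite /col /=; case: (occ vs y) => //; case: #|S| S1 => [|[|m]] //= _; by case: c hn.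
exists (rcons B S); split=> //=.
- split=> [i j a /mem[[hi li]|[hi ->]] /mem[[hj lj]|[hj ->]] //|i j a b ij].
  + exact: ((proj1 h1) _ _ _ hi hj).
  + by have := far _ hj; rewrite (block_covered hi).
  + by have := far _ hi; rewrite (block_covered hj).
  have cross i' a' b' : a' \in block B i' -> b' \in S -> C0 a' <> C0 b'.
    move=> ha hb /kept[e|[hp _]].
      have := far _ hb; move: hb; rewrite inE -e (rep_pos h2 ha) => /eqP/chart_inj e'.
      have := (proj2 h3) i'; rewrite e' ex -sz (block_size ha) => /(_ isT) //.
    have [m1 _] := h6 hp; rewrite inE -h5 -m1 => hb'; have := far _ hb.
    by case/orP: hb' => /block_covered->.
  move=> /mem[[hi li]|[hi ei]] /mem[[hj lj]|[hj ej]].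
  + exact: (proj2 h1).
  + by move=> _; apply: cross hi hj.
  + by move=> _ /esym; apply: cross hj hi.
  + by case: ij; rewrite ei ej.
- split.
  + by rewrite !size_rcons sz.
  + move=> i; rewrite size_rcons ltnS bE cE -sz => hi; case: ifP => [li|gi].
      by apply: (rep_col h2); rewrite -sz.
    by rewrite eqn_leq hi leqNgt gi.
  + move=> i; rewrite size_rcons ltnS cE -sz => hi; case: ifP => [li|gi].
      by apply: (rep_ne h2); rewrite -sz.
    by rewrite eqn_leq hi leqNgt gi /=; case: #|S| S1 => [|[|m]].
  + move=> i a /mem[[ha li]|[ha ->]]; rewrite pE; first by rewrite li; apply: (rep_pos h2).
    by rewrite ltnn eqxx; move: ha; rewrite inE => /eqP.
  + by [].
- split=> [y c|i].
    rewrite gget_gset occE; case: eqcP => [<- [<-]|xy].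
      split; last by move=> a; rewrite cov negb_or inE => /andP[/eqP].
      by case: (occ (us R) x) (@occ_unit (us R) x) => // -[//|i hi ei]; have := (proj2 h3) i hi; rewrite ei.
    move/(proj1 h3) => [-> cl]; split=> // a; rewrite cov negb_or => /andP[_]; exact: cl.
  rewrite size_rcons ltnS gget_gset pE -sz leq_eqVlt => /orP[/eqP->|li].
    by rewrite ltnn eqxx; case: eqcP.
  by rewrite li; case: eqcP => // _; apply: (proj2 h3); rewrite -sz.
- have e := bE 0; rewrite h50 h5 in e; split; [by rewrite size_rcons | exact: e].
- move=> hp; have [m1 sB] := h6 hp; have e := bE 1; rewrite sB m1 in e.
  split; [exact: e | rewrite size_rcons; exact: ltnW].
- rewrite map_rcons rcons_uniq h7 andbT; apply/negP => /(nthP 0%R)[i]; rewrite size_map => hi.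
  by rewrite (nth_map no_unit) // => /chart_inj e; have := (proj2 h3) i hi; rewrite /pos e.
Qed.

Lemma stayable_dec c u : stayable alg c u \/ ~ stayable alg c u.
Proof.
case: (pickP (fun p : 'I_6 * bool => alg (view_of c u (Labelling p.1 p.2)) == None)) => [p /eqP h|h].
  by left; eexists; exact: h.
by right=> -[[s b] e]; have := h (s, b); rewrite /= e.
Qed.

Lemma best_ok us ws b w : every want_ok ws -> (if b is Some (_, w') then want_ok w' else True) ->
  best tab max_units stacks us ws b = Some w -> want_ok w.
Proof.
elim: ws b => [|w' ws IH] b /=; first by case: b => // -[k w'] _ h [<-].
move=> [h1 h2] hb; apply: IH => //; case: b hb => [[k v]|] //; by case: ifP.
Qed.

Lemma weight_rcons us e :
  weight (rcons us e) = (if e.2 is Multiple then 2 else 1) + weight us.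
Proof. by elim: us => //= e' us ->; rewrite addnCA. Qed.

Lemma stacked x : observe #|[set a | Xr a == chart x]| = Multiple -> stacks.
Proof.
case: stackable => // inj; case e: #|_| => [|[|m]] // _.
have : 1 < #|[set a | Xr a == chart x]| by rewrite e.
case/card_gt1P => a [b [+ + ab]]; rewrite !inE => /eqP ea /eqP eb.
by case/eqP: ab; apply: inj; rewrite ea eb.
Qed.

(** The true answer to each question is among the branches: the actual content of the cell in [Xr],
    or the actual rule, namely that the robot can be made to stay or the orbit of one of its
    possible directions. Following the true answers keeps the world sound, so it cannot end in a
    refutation. *)
Lemma refute_ok fuel B W : sound B W -> refute paired tab max_units stacks fuel W -> False.
Proof.
elim: fuel B W => [|fuel IH] B W sW //.
rewrite /refute -/(refute paired tab max_units stacks); have := explore_sound sW.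
case: (explore _ _ _ _ _ _ _ _) => // ws seen hw.
have subT B' R t : ready B' R t ->
    (if make_world max_units R t is Some W' then refute paired tab max_units stacks fuel W'
     else true) -> False.
  move=> rd; have := make_world_ok rd.
  by case: (make_world _ _ _) => // W' sW'; apply: IH sW'.
case eb: (best _ _ _ _ _ _) => [w|] //; have wok := best_ok (b := None) hw I eb.
case: (sW) => rd _ _; case: w {eb} wok => [x|c u] wok.
  case ex: (isSome _) => //; have {}ex : gget (gr (root W)) x = None by case: (gget _ _) ex.
  have [B' rd'] := reveal_ok rd ex; have [] := budget (more := false) rd' (fun h => ltac:(by [])).
  rewrite !add0n; case es: (observe _) rd' => rd'.
  - by case: ifP => // /(subT _ _ _ rd').
  - rewrite /= size_rcons weight_rcons /can_single => -> /= h2; rewrite h2.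
    by case: ifP => // _; case: ifP => // /(subT _ _ _ rd').
  move=> b1 b2; have -> : can_multiple max_units stacks (us (root W)) = true.
    by move: b1 b2; rewrite /= size_rcons weight_rcons /can_multiple (stacked es) => -> /=; lia.
  by case: ifP => // _; case: ifP => // _ /(subT _ _ _ rd').
have learn_rd ds : rule_ok alg c u ds -> ready B (root W) (learn (alg_rules W) c u ds).
  by move=> hr; case: rd => *; split=> //; apply: learn_ok.
case: (stayable_dec c u) => hs.
  by case: ifP => // /(subT _ _ _ (learn_rd [::] hs)).
case: ifP => // _ /allP hall; have [d hd] := possible_ex hs.
have [su ne] := wok; have d6 := possible_lt hd.
have ed : nth Empty u d = Empty by case e: (nth Empty u d) => //; case: (ne d); rewrite ?e.
have [os hos [dos sos]] := tab_ok su d6 ed.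
apply: (subT _ _ _ (learn_rd os _) (hall _ hos)).
case: os dos sos {hos} => // d' os _ sos; split=> // d'' /sos h; exact: possible_orbit h hd.
Qed.

Lemma reveal_ring_ok B R t u ds : ready B R t ->
  (forall d, d \in ds -> observe #|[set a | Xr a == chart (nbr (Z0, Z0) d)]| = nth Empty u d) ->
  exists B', ready B' (reveal_ring R u ds) t.
Proof.
rewrite /reveal_ring; elim: ds B R => [|d ds IH] B R rd hu /=; first by exists B.
have hu' d' : d' \in ds -> observe #|[set a | Xr a == chart (nbr (Z0, Z0) d')]| = nth Empty u d'.
  by move=> hd; apply: hu; rewrite inE hd orbT.
case e: (isSome _); first exact: IH rd hu'.
have ex : gget (gr R) (nbr (Z0, Z0) d) = None by case: (gget _ _) e.
by have [B' rd'] := reveal_ok rd ex; rewrite hu ?mem_head // in rd'; apply: IH rd' hu'.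
Qed.

Lemma start_ok B R c u ds : ready B R TNil -> rule_ok alg c u ds ->
  (forall d : 'I_6, observe #|[set a | Xr a == chart (nbr (Z0, Z0) d)]| = nth Empty u d) ->
  if start max_units R c u ds is Some W then exists B', sound B' W else False.
Proof.
move=> rd hr hu; have hu' d : d \in six -> observe #|[set a | Xr a == chart (nbr (Z0, Z0) d)]| = nth Empty u d.
  have /allP h6 : all (fun d => d < 6) six by [].
  by move/h6 => hd; apply: (hu (Ordinal hd)).
have [B' rd'] := reveal_ring_ok rd hu'.
have [b1 b2] := budget (more := false) rd' (fun h => ltac:(by [])).
rewrite /start; rewrite !add0n in b1 b2; rewrite b1 b2.
have rdl : ready B' (reveal_ring R u six) (learn TNil c u ds).
  by case: rd' => *; split=> //; apply: learn_ok => //; apply: rules_TNil.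
by have := make_world_ok rdl; case: (make_world _ _ _) => // W sW; exists B'.
Qed.

Lemma gget_empty y : gget (PositiveMap.empty _) y = None.
Proof. by rewrite /gget /grow PositiveMap.gempty PositiveMap.gempty. Qed.

Lemma lone_ok : ~~ paired -> low = [set a | Xr a == chart (Z0, Z0)] -> low != set0 ->
  ready [:: low] (lone (observe #|low|)) TNil.
Proof.
move=> np el l0; have cl : forall a, ~~ covered [:: low] a -> Xr a <> chart (Z0, Z0).
  by move=> a; rewrite /covered /= orbF el inE => /eqP.
have b0 i a : a \in block [:: low] i -> i = 0 by case: i => [|[|i]] //; rewrite inE.
have gE y : gget (gr (lone (observe #|low|))) y = if eqc (Z0, Z0) y then Some (observe #|low|) else None.
  by rewrite gget_gset; case: ifP => // _; apply: gget_empty.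
split; try exact: rules_TNil; try by [].
- split=> [i j a /b0-> /b0-> //|i j a b ij /b0 ei /b0 ej]; by case: ij; rewrite ei ej.
- split=> //= [[|i] //|[|i] // _|i a h].
    by move: l0; rewrite -card_gt0 /col /=; case: #|low| => [|[|m]].
  by have ei := b0 _ _ h; subst i; move: h; rewrite /block /= el inE => /eqP.
- split=> [y c|i]; last by rewrite [size _]/= ltnS leqn0 gE => /eqP->.
  rewrite gE; by case: eqcP => // <- [<-]; split=> //=; case: eqcP.
- by move=> h; rewrite h in np.
Qed.

Lemma nbr0_inj (d e : 'I_6) : nbr (Z0, Z0) d = nbr (Z0, Z0) e -> d = e.
Proof.
by case: d e => -[|[|[|[|[|[|i]]]]]] // hi [[|[|[|[|[|[|j]]]]]] // hj] //= _; apply: val_inj.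
Qed.

Lemma chart_nbr_neq (d : 'I_6) : chart (Z0, Z0) <> chart (nbr (Z0, Z0) d).
Proof. by move/chart_inj => e; case: (@nbr_neq (Z0, Z0) d). Qed.

Lemma couple_ok (d : 'I_6) : paired -> low = [set a | Xr a == chart (Z0, Z0)] ->
  mate = [set a | Xr a == chart (nbr (Z0, Z0) d)] -> #|low| = 1 -> #|mate| = 1 ->
  ready [:: low; mate] (couple d) TNil.
Proof.
move=> hp el em l1 m1; have hx := @chart_nbr_neq d.
have [uE gE] : us (couple d) = [:: ((Z0, Z0), Single); (nbr (Z0, Z0) d, Single)] /\
    forall y, gget (gr (couple d)) y =
      if eqc (nbr (Z0, Z0) d) y then Some Single else if eqc (Z0, Z0) y then Some Single else None.
  by split=> // y; rewrite !gget_gset; case: ifP => // _; case: ifP => // _; apply: gget_empty.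
move: (couple d) (nbr (Z0, Z0) d) uE gE em hx => R x uE gE em hx.
have hl i a : a \in block [:: low; mate] i ->
    i < 2 /\ Xr a = chart (pos [:: ((Z0, Z0), Single); (x, Single)] i).
  by case: i => [|[|i]]; rewrite /block /= ?nth_nil ?el ?em ?inE // => /eqP.
have far a : ~~ covered [:: low; mate] a -> Xr a <> chart (Z0, Z0) /\ Xr a <> chart x.
  by rewrite /covered /= orbF el em !inE negb_or => /andP[/eqP h1 /eqP h2].
split; rewrite ?uE; try exact: rules_TNil; try by [].
- split=> [i j a /hl[hi ei] /hl[hj]|i j a b _ /hl[hi _] /hl[hj _]]; last first.
    by rewrite /pair_units /in_pair hp hi hj.
  rewrite ei => /chart_inj; move: i j hi hj {ei} => [|[|i]] [|[|j]] // _ _; rewrite /pos /= => e;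
    by case: hx; rewrite e.
- by split=> // [[|[|i]]|[|[|i]]|i a /hl[]] //; rewrite /block /= ?l1 ?m1.
- split=> [y c|i hi]; rewrite gE.
    have zx : eqc x (Z0, Z0) = false by apply/eqcP => e; case: hx; rewrite e.
    have xz : eqc (Z0, Z0) x = false by apply/eqcP => e; case: hx; rewrite e.
    case: eqcP => [<- [<-]|_].
      by rewrite /= xz (introT (eqcP x x) erefl); split=> // a /far[].
    case: eqcP => // <- [<-]; by rewrite /= zx; split=> // a /far[].
  by case: i hi => [|[|i]] // _; rewrite /pos /=; case: eqcP => // h; case: eqcP.
- by rewrite /= andbT inE; apply/eqP.
Qed.

Lemma root_view u l : size u = 6 ->
  (forall d : 'I_6, observe #|[set a | Xr a == chart (nbr (Z0, Z0) d)]| = nth Empty u d) ->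
  look (conf Xr) (chart (Z0, Z0)) (lab_comp g l) =
    view_of (observe #|[set a | Xr a == chart (Z0, Z0)]|) u l.
Proof.
move=> su hu; congr View; apply/ffunP => j.
by rewrite !ffunE lab_dir_comp -chart_nbr -hu.
Qed.

(** The first unit cannot stay, so some direction is possible for it. That direction is free, since
    a move onto an occupied neighbour would bring together robots that are apart in [Xr] and hence,
    by [kept], started apart. Its orbit is therefore one of the options. *)
Lemma refute_lone u fuel : ~~ paired -> low = [set a | Xr a == chart (Z0, Z0)] -> low != set0 ->
  size u = 6 ->
  (forall d : 'I_6, observe #|[set a | Xr a == chart (nbr (Z0, Z0) d)]| = nth Empty u d) ->
  (forall a l, a \in low -> destination alg (conf Xr) a l <> Xr a) ->
  (forall os, os \in options tab u ->
     if start max_units (lone (observe #|low|)) (observe #|low|) u os is Some W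
     then refute paired tab max_units stacks fuel W else true) -> False.
Proof.
move=> np el l0 su hu hl hr; case/set0Pn: (l0) => a0 ha0.
have pa a : a \in low -> Xr a = chart (Z0, Z0) by rewrite el inE => /eqP.
have rv l := root_view l su hu; rewrite -el in rv.
have ns : ~ stayable alg (observe #|low|) u.
  case=> l hs; apply: (hl a0 (lab_comp g l) ha0).
  by rewrite /destination /conf (pa _ ha0) rv hs.
have [d hd] := possible_ex ns; have d6 := possible_lt hd.
have [l hdest] : exists l, destination alg (conf Xr) a0 l = chart (nbr (Z0, Z0) d).
  case: (hd) => l [j [h ej]]; exists (lab_comp g l).
  by rewrite /destination /conf (pa _ ha0) rv h lab_dir_comp -ej -chart_nbr.
have ed : nth Empty u d = Empty.
  have := hu (Ordinal d6); rewrite [nat_of_ord _]/= => <-; case: (set_0Vmem [set a | Xr a == chart (nbr (Z0, Z0) d)]) => [->|[b]].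
    by rewrite cards0.
  rewrite inE => /eqP hb; pose rd : {set 'I_n} * ('I_n -> labelling) := ([set a0], fun=> l).
  have rY : reachable (step alg Xr rd).
    by apply: reachable_step => //; apply/set0Pn; exists a0; rewrite inE.
  have ab : b != a0.
    by apply/eqP => e; move: hb; rewrite e (pa _ ha0) => /(@chart_nbr_neq (Ordinal d6)).
  have : C0 a0 = C0 b.
    by apply: (meet_start rY); rewrite !ffunE /= !inE eqxx (negbTE ab) hdest hb.
  case/kept => [|[hp _]]; last by rewrite hp in np.
  by rewrite (pa _ ha0) hb => /(@chart_nbr_neq (Ordinal d6)).
have [os hos [dos sos]] := tab_ok su d6 ed.
have ro : rule_ok alg (observe #|low|) u os.
  by case: os dos sos {hos} => // d' os _ sos; split=> // d'' /sos h; apply: possible_orbit h hd.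
have := hr _ hos; have := start_ok (lone_ok np el l0) ro hu.
case: (start _ _ _ _ _) => // W [B sW]; exact: refute_ok sW.
Qed.

Lemma dir_orbit_self u d : size u = 6 -> d < 6 -> d \in dir_orbit u d.
Proof.
move=> su d6; rewrite mem_undup; apply/mapP; exists (0, false).
  rewrite mem_filter; apply/andP; split=> //; apply/eqvP.
  by case: u su => [|o0 [|o1 [|o2 [|o3 [|o4 [|o5 [|]]]]]]].
by rewrite /lab /= add0n d6.
Qed.

(** Here the rule of the moving robot is known at the root: it can be sent onto its partner, so the
    orbit of the partner's direction is available. *)
Lemma refute_couple u (d : 'I_6) fuel : paired -> low = [set a | Xr a == chart (Z0, Z0)] ->
  mate = [set a | Xr a == chart (nbr (Z0, Z0) d)] -> #|low| = 1 -> #|mate| = 1 -> size u = 6 ->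
  (forall d : 'I_6, observe #|[set a | Xr a == chart (nbr (Z0, Z0) d)]| = nth Empty u d) ->
  (forall a l, a \in low -> destination alg (conf Xr) a l <> Xr a) ->
  (forall a, a \in low -> exists l, destination alg (conf Xr) a l = chart (nbr (Z0, Z0) d)) ->
  (if start max_units (couple d) Single u (dir_orbit u d) is Some W
   then refute paired tab max_units stacks fuel W else true) -> False.
Proof.
move=> hp el em l1 m1 su hu hl hd hr; have /card_gt0P[a0 ha0] : 0 < #|low| by rewrite l1.
have pa : Xr a0 = chart (Z0, Z0) by move: ha0; rewrite el inE => /eqP.
have rv l := root_view l su hu; rewrite -el l1 in rv.
have ns : ~ stayable alg Single u.
  case=> l hs; apply: (hl a0 (lab_comp g l) ha0).
  by rewrite /destination /conf pa rv hs.
have ps : possible alg Single u d.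
  have [l] := hd _ ha0; exists (lab_comp (lab_inv g) l); move: p; rewrite /destination /conf pa.
  have -> : look (conf Xr) (chart (Z0, Z0)) l = view_of Single u (lab_comp (lab_inv g) l).
    by rewrite -rv; congr View; apply/ffunP => j; rewrite !ffunE !lab_dir_comp lab_invKV.
  case: (alg _) => [j|]; last by move/(@chart_nbr_neq d).
  move=> e; exists j; split=> //; congr nat_of_ord.
  rewrite lab_dir_comp; rewrite -[lab_dir l j](lab_invKV g) -chart_nbr in e.
  exact/nbr0_inj/(chart_inj e).
have ro : rule_ok alg Single u (dir_orbit u d).
  have := dir_orbit_self su (ltn_ord d); case eo: (dir_orbit u d) => [|d' os] // _.
  by split=> // d''; rewrite -eo => h; apply: possible_orbit h ps.
move: hr; have := start_ok (couple_ok hp el em l1 m1) ro hu.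
case: (start _ _ _ _ _) => // W [B sW]; exact: refute_ok sW.
Qed.
End Soundness.

(** * The configurations from which the search starts *)

Definition ternary := [:: Empty; Single; Multiple].
Definition lone_refuted m st c tab u :=
  all (fun o => if start m (lone c) c u o is Some W then refute false tab m st 200 W else true)
    (options tab u).
Definition check_lone m st c os tab := all (lone_refuted m st c tab) (roots os).
Definition couple_refuted tab u :=
  all (fun d => if start 6 (couple d) Single u (dir_orbit u d) is Some W
                then refute true tab 6 false 200 W else true) (single_dirs u).
Definition check_couple tab := all (couple_refuted tab) (roots [:: Empty; Single]).

(** The three roots: up to six single robots with distinct starts; at most four starting points,
    where the unit that has to move is a stack; and six single robots, two of which started together
    and one of these attacks the other. *)
Lemma check_singles : check_lone 6 false Single [:: Empty; Single] table.
Proof. by vm_compute. Qed.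
Lemma check_stack : check_lone 4 true Multiple ternary table.
Proof. by vm_compute. Qed.
Lemma check_pair : check_couple table.
Proof. by vm_compute. Qed.

Lemma canonical_all : all (fun u => has (fun l => canonical (relabel u l)) labs) (views ternary 6).
Proof. by vm_compute. Qed.

Lemma table_all (tab := table) : all (fun u => all (fun d => if is_empty (nth Empty u d) then
  has (fun os => if d \in os then all (fun d' => d' \in dir_orbit u d) os else false) (options tab u)
  else true) (iota 0 6)) (views ternary 6).
Proof. by vm_compute. Qed.

Lemma has_ternary o : has (eqo o) ternary. Proof. by case: o. Qed.

Lemma all_ternary u : all (fun o => has (eqo o) ternary) u.
Proof. by elim: u => //= o u ->; rewrite andbT; case: o. Qed.

Lemma table_ok u d : size u = 6 -> d < 6 -> nth Empty u d = Empty ->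
  exists2 os, os \in options table u & d \in os /\ {subset os <= dir_orbit u d}.
Proof.
move=> su d6 ed; have /allP := all_views table_all su (all_ternary u).
have hd : d \in iota 0 6 by rewrite mem_iota.
move/(_ _ hd); rewrite ed /= => /hasP[os hos].
by case: ifP => // dos /allP sos; exists os.
Qed.

Lemma roots_all os (P : pred (seq occupancy)) u : all P (roots os) -> size u = 6 ->
  all (fun o => has (eqo o) os) u -> canonical u -> P u.
Proof.
rewrite /roots all_filter => h su hu cu.
by have := all_views h su hu; rewrite /= cu.
Qed.

Lemma chart0 g p : chart g p (Z0, Z0) = p.
Proof. by case: p => x y; rewrite /chart /= !mulr0 !addr0. Qed.

(* Keeps tactics from running the search. *)
Opaque refute start table.

Section Roots.
Variables (n : nat) (alg : algorithm) (C0 : config n).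
Notation cfg := {ffun 'I_n -> point}.
Notation reachable := (reachable alg C0).
Notation leads := (@leads n alg).
Hypothesis no_cycle : forall X, reachable X -> ~ leads X X.
Hypothesis meet_start : forall X i j, reachable X -> X i = X j -> C0 i = C0 j.
Hypothesis not_stuck : forall (X : cfg) (l : 'I_n -> labelling), reachable X ->
  exists i, destination alg (conf X) i (l i) != X i.
Hypothesis n_le6 : n <= 6.
Variables (Xr : cfg) (low : {set 'I_n}).
Hypothesis calm : forall a, a \notin low -> exists l, destination alg (conf Xr) a l = Xr a.
Hypothesis reachable_root : reachable Xr.
Hypothesis moving : forall a l, a \in low -> destination alg (conf Xr) a l <> Xr a.

(** The labelling of the chart is free, so it absorbs the symmetry that brings the view at [p] into
    canonical form. *)
Lemma good_labelling os p :
  (forall q, has (eqo (observe #|[set a | Xr a == q]|)) os) ->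
  exists g u, [/\ size u = 6, canonical u, all (fun o => has (eqo o) os) u &
    forall d : 'I_6, observe #|[set a | Xr a == chart g p (nbr (Z0, Z0) d)]| = nth Empty u d].
Proof.
move=> hos; pose f d := observe #|[set a | Xr a == (p + offset (inord d))%R]|.
pose u0 := [seq f d | d <- iota 0 6].
have su0 : size u0 = 6 by rewrite size_map size_iota.
have /hasP[l hl cl] := all_views canonical_all su0 (all_ternary u0).
have uE (d : 'I_6) : nth Empty (relabel u0 l) d = f (lab_dir (lab_of l) d).
  rewrite nth_relabel // -lab_ofE // (nth_map 0) ?size_iota ?ltn_ord // nth_iota ?ltn_ord //.
exists (lab_of l), (relabel u0 l); split=> //.
  apply/(all_nthP Empty) => i; rewrite size_relabel => hi; rewrite (uE (Ordinal hi)); exact: hos.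
by move=> d; rewrite uE /f inord_val chart_nbr chart0.
Qed.

Lemma lone_root os c m (st : bool) p : low = [set a | Xr a == p] -> low != set0 -> observe #|low| = c ->
  (forall a b, C0 a = C0 b -> Xr a = Xr b) -> size (undup (codom Xr)) <= m ->
  st \/ injective Xr -> (forall q, has (eqo (observe #|[set a | Xr a == q]|)) os) ->
  check_lone m st c os table -> False.
Proof.
move=> el l0 ec kept few stk hos chk.
have [g [u [su cu au hu]]] := good_labelling p hos.
have := roots_all chk su au cu; rewrite /lone_refuted => /allP hr.
apply: (@refute_lone n alg C0 no_cycle meet_start not_stuck g p false Xr low calm set0 table m st
  reachable_root n_le6 _ few stk table_ok u 200) => //.
- by move=> a b /kept; left.
- by rewrite chart0.
- by rewrite ec.
Qed.

Lemma couple_root i j : low = [set i] -> i != j -> injective Xr ->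
  (forall a b, C0 a = C0 b -> a = b \/ (a \in [set i; j]) /\ (b \in [set i; j])) ->
  (exists l, destination alg (conf Xr) i l = Xr j) -> False.
Proof.
move=> el ij inj kept [l hl].
have one a : [set b | Xr b == Xr a] = [set a].
  by apply/setP => b; rewrite !inE (inj_eq inj).
have hos q : has (eqo (observe #|[set a | Xr a == q]|)) [:: Empty; Single].
  case: (set_0Vmem [set a | Xr a == q]) => [->|[a]]; first by rewrite cards0.
  by rewrite inE => /eqP<-; rewrite one cards1.
have [g [u [su cu au hu]]] := good_labelling (Xr i) hos.
have [d hd] : exists d : 'I_6, Xr j = chart g (Xr i) (nbr (Z0, Z0) d).
  move: hl; rewrite /destination /conf; case: (alg _) => [k|] hk; last first.
    by case/eqP: ij; apply: inj.
  exists (lab_dir (lab_inv g) (lab_dir l k)).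
  by rewrite chart_nbr chart0 lab_invKV.
have := roots_all check_pair su au cu; rewrite /couple_refuted => /allP hr.
have hd' : nat_of_ord d \in single_dirs u.
  by rewrite mem_filter mem_iota /= -hu -hd one cards1 /= ltn_ord.
apply: (@refute_couple n alg C0 no_cycle meet_start not_stuck g (Xr i) true Xr low calm [set j] table 6 false
  reachable_root n_le6 _ _ _ table_ok u d 200) => //.
- move=> a b /kept[->|[ha hb]]; [by left | right]; by rewrite el.
- apply: leq_trans (size_undup _) _; by rewrite size_codom card_ord.
- by right.
- by rewrite chart0 one.
- by rewrite -hd one.
- by rewrite el cards1.
- by rewrite cards1.
- by move=> a; rewrite el inE => /eqP->; exists l; rewrite hl.
- exact: (hr _ hd').
Qed.
End Roots.

Opaque check_lone check_couple.

(** * Strategies of the adversary that lead to the roots *)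

Section Marching.
Variables (n : nat) (alg : algorithm) (C0 : config n) (w : point) (t : nat).
Hypotheses (n_gt0 : 0 < n) (w_neq0 : w != 0%R) (t_gt0 : 0 < t).
Hypothesis march : forall E, ssync_execution alg C0 E -> forall m, 0 < m ->
  (exists r, steps E r = m * t) /\
  (forall r, steps E r = m * t -> forall i, E r i = (C0 i + w *+ m)%R).
Hypothesis n_le6 : n <= 6.
Notation cfg := {ffun 'I_n -> point}.
Notation reachable := (reachable alg C0).
Notation dest X a l := (destination alg (conf X) a l).

Let nostuck := @not_stuck n alg C0 w t n_gt0 w_neq0 t_gt0 march.
Let nocycle := @no_cycle n alg C0 w t n_gt0 w_neq0 t_gt0 march.
Let meet := @meet_start n alg C0 w t n_gt0 w_neq0 t_gt0 march.
Let perp := @perpetual n alg C0 w t n_gt0 w_neq0 t_gt0 march.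

Definition calm (X : cfg) a := exists l, dest X a l = X a.

Lemma moves_all (X : cfg) a : ~ calm X a -> forall l, dest X a l <> X a.
Proof. by move=> h l e; apply: h; exists l. Qed.

(** As long as another starting class has to move, that class is moved as a whole and the class of
    [a0] waits. This cannot last, because [a0] has to advance by [w]. When it ends, all other robots
    can stay, so by [not_stuck] the class of [a0] cannot. *)
Lemma class_root a0 : exists X, [/\ reachable X, forall a b, C0 a = C0 b -> X a = X b,
  forall a, C0 a <> C0 a0 -> calm X a & forall a l, C0 a = C0 a0 -> dest X a l <> X a].
Proof.
pose Q (Y : cfg) := (forall a b, C0 a = C0 b -> Y a = Y b) /\ Y a0 = C0 a0.
have [[X [rX [kX _] cX]]|no] := classic (exists X, [/\ reachable X, Q X & forall a, C0 a <> C0 a0 -> calm X a]).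
  exists X; split=> // a l ea el.
  (* One labelling that lets [a] stay serves its whole class, which stands at the same point. *)
  have hc b : exists l', dest X b l' = X b.
    case: (C0 b =P C0 a0) => [eb|]; last exact: cX.
    exists l; have eab : X b = X a by apply: kX; rewrite ea.
    by move: el; rewrite /destination /conf eab.
  have [f hf] := fin_all_exists hc.
  by have [b] := nostuck f rX; rewrite hf eqxx.
exfalso; have prog Y : reachable Y -> Q Y ->
    exists r : {set 'I_n} * ('I_n -> labelling), [/\ r.1 != set0, Q (step alg Y r) & step alg Y r != Y].
  move=> rY [kY lY].
  have [b [nb hb]] : exists b, C0 b <> C0 a0 /\ ~ calm Y b.
    apply: NNPP => h; apply: no; exists Y; split=> // a ha; apply: NNPP => hc; apply: h; by exists a.
  exists ([set a | C0 a == C0 b], fun=> lab0); split=> /=.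
  - by apply/set0Pn; exists b; rewrite inE.
  - split=> [a a' e|]; rewrite !ffunE !inE /=; last by case: eqP => // e; case: nb.
    by rewrite e /destination /conf (kY _ _ e).
  - apply/eqP => /ffunP/(_ b); rewrite ffunE /= inE eqxx; exact: moves_all hb _.
have Q0 : Q (init C0) by split=> [a b|]; rewrite !ffunE.
have [s [_ [_ h]]] := perp prog (s0 := [::]) isT erefl Q0 (m := 1) isT.
move=> _ /(_ a0); rewrite h -[LHS]addr0 => /addrI/esym/eqP.
by rewrite mulr1n (negbTE w_neq0).
Qed.

(** If [i] and [j] were inseparable, activating a single moving robot per round would never move
    [i], as this would leave [j] behind; but [i] has to advance by [w]. *)
Lemma split_pair i j : C0 i = C0 j -> i != j -> exists2 X, reachable X & X i <> X j.
Proof.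
move=> e0 ij; apply: NNPP => no.
have same Y : reachable Y -> Y i = Y j by move=> rY; apply: NNPP => h; apply: no; exists Y.
pose Q (Y : cfg) := Y i = C0 i.
have prog Y : reachable Y -> Q Y ->
    exists r : {set 'I_n} * ('I_n -> labelling), [/\ r.1 != set0, Q (step alg Y r) & step alg Y r != Y].
  move=> rY qY; have [x hx] := nostuck (fun=> lab0) rY.
  have x0 : [set x] != set0 by apply/set0Pn; exists x; rewrite inE.
  exists ([set x], fun=> lab0); split=> //=; last first.
    by apply: contra hx => /eqP/ffunP/(_ x); rewrite ffunE /= inE eqxx => ->.
  have rY' : reachable (step alg Y ([set x], fun=> lab0)) by apply: reachable_step.
  rewrite /Q ffunE /= inE; case: eqP => [ei|_]; last exact: qY.
  have := same _ rY'; rewrite !ffunE /= !inE -ei eqxx eq_sym (negbTE ij) -(same _ rY) ei => e.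
  by rewrite e eqxx in hx.
have Q0 : Q (init C0) by rewrite /Q ffunE.
have [s [_ h]] := perp prog (s0 := [::]) isT erefl Q0 (m := 1) isT.
move=> _ /(_ i); rewrite h -[LHS]addr0 => /addrI/esym/eqP.
by rewrite mulr1n (negbTE w_neq0).
Qed.

Definition attack (X : cfg) u v := [/\ reachable X, X u <> X v, ~ calm X u,
  (exists l, dest X u l = X v) & forall a, a != u -> calm X a].

(** Prescribed configurations have [i] and [j] together, so after being separated they cannot be
    kept apart forever. Other robots that have to move are moved first; the attempt to keep the pair
    apart then fails only when exactly one of the two has to move and it would enter the point of
    the other. *)
Lemma pair_root i j : C0 i = C0 j -> i != j -> exists X, attack X i j \/ attack X j i.
Proof.
move=> e0 ij; apply: NNPP => no; have [X0 [s0 vs0 rs0] ne0] := split_pair e0 ij.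
pose Q (Y : cfg) := Y i <> Y j.
have ji : (j == i) = false by rewrite eq_sym (negbTE ij).
have prog Y : reachable Y -> Q Y ->
    exists r : {set 'I_n} * ('I_n -> labelling), [/\ r.1 != set0, Q (step alg Y r) & step alg Y r != Y].
  move=> rY qY.
  have one x : ~ calm Y x -> Q (step alg Y ([set x], fun=> lab0)) ->
      exists r : {set 'I_n} * ('I_n -> labelling), [/\ r.1 != set0, Q (step alg Y r) & step alg Y r != Y].
    move=> hx hQ; exists ([set x], fun=> lab0); split=> //=.
      by apply/set0Pn; exists x; rewrite inE.
    apply/eqP => /ffunP/(_ x); rewrite ffunE /= inE eqxx; exact: moves_all hx _.
  have [[x [nx xi xj]]|others] := classic (exists x, [/\ ~ calm Y x, x != i & x != j]).
    by apply: (one x nx); rewrite /Q !ffunE /= !inE eq_sym (negbTE xi) eq_sym (negbTE xj).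
  have calm_others a : a != i -> a != j -> calm Y a.
    by move=> ai aj; apply: NNPP => h; apply: others; exists a.
  have [ci|ni] := classic (calm Y i); have [cj|nj] := classic (calm Y j).
  - exfalso; have hc b : exists l, dest Y b l = Y b.
      by case: (b =P i) => [->//|/eqP bi]; case: (b =P j) => [->//|/eqP bj]; apply: calm_others.
    have [f hf] := fin_all_exists hc.
    by have [b] := nostuck f rY; rewrite hf eqxx.
  - apply: (one j nj); rewrite /Q !ffunE /= !inE eqxx (negbTE ij) => e.
    apply: no; exists Y; right; split=> //; [by move/esym | by exists lab0 | move=> a aj].
    by case: (a =P i) => [->//|/eqP ai]; apply: calm_others.
  - apply: (one i ni); rewrite /Q !ffunE /= !inE eqxx ji => e.
    apply: no; exists Y; left; split=> //; [by exists lab0 | move=> a ai].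
    by case: (a =P j) => [->//|/eqP aj]; apply: calm_others.
  case: (dest Y i lab0 =P Y j) => [ei|nei]; last first.
    by apply: (one i ni); rewrite /Q !ffunE /= !inE eqxx ji.
  case: (dest Y j lab0 =P Y i) => [ej|nej]; last first.
    by apply: (one j nj); rewrite /Q !ffunE /= !inE eqxx (negbTE ij); move/esym.
  (* Each would move onto the other, so both are activated and exchange places. *)
  exists ([set i; j], fun=> lab0); split=> /=.
  - by apply/set0Pn; exists i; rewrite !inE eqxx.
  - by rewrite /Q !ffunE /= !inE !eqxx orbT ei ej; move/esym.
  - by apply/eqP => /ffunP/(_ i); rewrite ffunE /= !inE eqxx; apply: moves_all ni _.
have [s [_ h _ hl]] := perp prog vs0 rs0 ne0 (ltnSn _).
by apply: h; rewrite !hl e0.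
Qed.

Lemma distinct_le (F G : 'I_n -> point) : (forall a b, G a = G b -> F a = F b) ->
  size (undup (codom F)) <= size (undup (codom G)).
Proof.
move=> h; pose r q := if [pick a | G a == q] is Some a then F a else 0%R.
have rG a : r (G a) = F a.
  by rewrite /r; case: pickP => [b /eqP/h //|/(_ a)]; rewrite eqxx.
rewrite -[X in _ <= X](size_map r); apply: uniq_leq_size; first exact: undup_uniq.
move=> q; rewrite mem_undup => /codomP[a ->]; rewrite -rG; apply: map_f.
by rewrite mem_undup codom_f.
Qed.

(** Leaving out [x] and [y] loses no starting point. *)
Lemma two_spare x y x' y' : x != y -> x' \notin [set x; y] -> y' \notin [set x; y] ->
  C0 x = C0 x' -> C0 y = C0 y' -> size (undup (codom C0)) <= n - 2.
Proof.
move=> xy hx hy ex ey.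
have : size (undup (codom C0)) <= size [seq C0 a | a <- enum (~: [set x; y])].
  apply: uniq_leq_size; first exact: undup_uniq.
  move=> q; rewrite mem_undup => /codomP[a ->].
  case: (a =P x) => [->|/eqP ax]; first by rewrite ex map_f // mem_enum inE.
  case: (a =P y) => [->|/eqP ay]; first by rewrite ey map_f // mem_enum inE.
  by rewrite map_f // mem_enum !inE negb_or ax ay.
by rewrite size_map -cardE cardsCs setCK cards2 xy card_ord.
Qed.

Lemma impossible : False.
Proof.
have lone a0 m (st : bool) c os (X : cfg) : reachable X -> (forall a b, C0 a = C0 b -> X a = X b) ->
    (forall a, C0 a <> C0 a0 -> calm X a) -> (forall a l, C0 a = C0 a0 -> dest X a l <> X a) ->
    observe #|[set a | C0 a == C0 a0]| = c -> size (undup (codom C0)) <= m -> st \/ injective X ->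
    (forall q, has (eqo (observe #|[set a | X a == q]|)) os) -> check_lone m st c os table -> False.
  move=> rX kX cX mX ec hm hst hos; have lE : [set a | C0 a == C0 a0] = [set a | X a == X a0].
    apply/setP => a; rewrite !inE; apply/eqP/eqP => [/kX//|]; exact: meet.
  apply: (@lone_root n alg C0 nocycle meet nostuck n_le6 X [set a | C0 a == C0 a0] _ rX _ os c m st (X a0)) => //.
  - by move=> a; rewrite inE => /eqP/cX.
  - by move=> a l; rewrite inE => /eqP; apply: mX.
  - by apply/set0Pn; exists a0; rewrite inE.
  - by apply: leq_trans hm; apply: distinct_le => a b; apply: kX.
have [/injectiveP inj|] := boolP (injectiveb C0).
  have [X [rX kX cX mX]] := class_root (Ordinal n_gt0).
  have injX : injective X by move=> a b /(meet rX)/inj.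
  refine (lone (Ordinal n_gt0) 6 false Single [:: Empty; Single] X rX kX cX mX _ _ _ _ check_singles).
  - rewrite (_ : [set a | _] = [set Ordinal n_gt0]) ?cards1 //.
    by apply/setP => a; rewrite !inE (inj_eq inj).
  - by apply: leq_trans (size_undup _) _; rewrite size_codom card_ord.
  - by right.
  - move=> q; case: (set_0Vmem [set a | X a == q]) => [->|[a]]; first by rewrite cards0.
    rewrite inE => /eqP<-; rewrite (_ : [set b | _] = [set a]) ?cards1 //.
    by apply/setP => b; rewrite !inE (inj_eq injX).
move/injectivePn => [i [j ij eij]].
case: (leqP (size (undup (codom C0))) 4) => [few|many].
  have [X [rX kX cX mX]] := class_root i.
  refine (lone i 4 true Multiple ternary X rX kX cX mX _ few _ _ check_stack); last first.
  - by move=> q; apply: has_ternary.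
  - by left.
  have : 1 < #|[set a | C0 a == C0 i]|.
    by apply/card_gt1P; exists i, j; rewrite !inE eqxx -eij eqxx.
  by case: #|_| => [|[|k]].
have only a b : C0 a = C0 b -> a = b \/ (a \in [set i; j]) /\ (b \in [set i; j]).
  move=> eab; case: (a =P b) => [->|/eqP ab]; [by left | right].
  have no x y x' y' : x != y -> x' \notin [set x; y] -> y' \notin [set x; y] ->
      C0 x = C0 x' -> C0 y = C0 y' -> False.
    move=> h1 h2 h3 h4 h5; have := two_spare h1 h2 h3 h4 h5; lia.
  apply: NNPP => hn.
  (* By symmetry in [i], [j] and in [a], [b] it may be assumed that [a] lies outside the pair; then
     the starts of both [a] and [j] are also represented by other robots. *)
  wlog nai : i j ij eij hn / a != i.
    move=> W; case: (a =P i) => [e|/eqP]; last exact: W hn.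
    by apply: (W j i); [rewrite eq_sym | | rewrite setUC | rewrite e].
  wlog naj : a b ab eab hn nai / a != j.
    move=> W; case: (a =P j) => [e|/eqP]; last exact: (W a b ab eab hn nai).
    apply: (W b a); [by rewrite eq_sym | by [] | by move=> [h1 h2]; apply: hn | | by rewrite eq_sym -e].
    by apply/eqP => e'; apply: hn; rewrite !inE e e' !eqxx orbT.
  case: (b =P j) => [bj|/eqP bj].
    apply: (no a j i i) => //; rewrite ?inE ?negb_or 1?eq_sym ?nai ?ij //.
    by rewrite eab bj -eij.
  apply: (no a j b i) => //; rewrite ?inE ?negb_or; first by rewrite eq_sym ab.
  by rewrite eq_sym nai ij.
have [X att] := pair_root eij ij.
have couple u v : u != v -> (forall a, a \in [set u; v] = (a \in [set i; j])) -> attack X u v -> False.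
  move=> uv huv [rX ne nu dX cX].
  apply: (@couple_root n alg C0 nocycle meet nostuck n_le6 X [set u] _ rX _ u v) => //.
  - by move=> a; rewrite inE => /cX.
  - by move=> a l; rewrite inE => /eqP->; apply: moves_all.
  - move=> a b eab; have := meet rX eab; case/only => // -[].
    rewrite -!huv !inE => /orP[]/eqP ea /orP[]/eqP eb; rewrite ea eb // in eab *.
    by case: ne; rewrite eab.
  - by move=> a b /only[->|[ha hb]]; [left | right]; rewrite ?huv.
case: att; first exact: couple.
by apply: couple => [|a]; rewrite 1?eq_sym // setUC.
Qed.
End Marching.

Theorem theorem2 (n : nat) (hn : 1 <= n <= 6) :
  ~ exists alg : algorithm, solves_perpetual_marching n alg.
Proof.
case/andP: hn => n0 n6 [alg [C0 [w [t [w0 t0 h]]]]].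
exact: (impossible n0 w0 t0 h n6).
Qed.
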